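(* Let $p/q\in(0,1/2)$ be a rational number with $\gcd(p,q)=1$, let $n\ge1$ be an integer, and let $\Gamma_\epsilon$ be a polynomial deformation of the unit circle of degree $\le n$. Then the $p/q$-resonant caustic of the unit circle $\mathrm O(\epsilon^{\chi-1})$-persists under $\Gamma_\epsilon$, where $$\chi=\chi(\Gamma_\epsilon,q)=\begin{cases}1+2\lceil (q-n)/2n\rceil,&\text{for anti-centrally symmetric }\Gamma_\epsilon\text{ and odd }q,\\ 2\lceil q/2n\rceil,&\text{for anti-centrally symmetric }\Gamma_\epsilon\text{ and even }q,\\ \lceil 2q/n\rceil,&\text{for centrally symmetric }\Gamma_\epsilon\text{ and odd }q,\\ \lceil q/n\rceil,&\text{otherwise.}\end{cases}$$
   Context: Smooth means $C^\infty$; $\mathbb T=\mathbb R/2\pi\mathbb Z$; $\lceil x\rceil=\min\{k\in\mathbb Z:k\ge x\}$; $(q-n)/2n$ means $(q-n)/(2n)$ and $q/2n$ means $q/(2n)$. The symbol $\asymp$ denotes an asymptotic (Taylor) expansion as $\epsilon\to0$. Billiards. Let $\Gamma$ be a smooth strictly convex closed curve in $\mathbb R^2\simeq\mathbb C$, oriented counterclockwise, with the origin in its interior. Its support function $h$ is the positive smooth $2\pi$-periodic function such that $z(\psi)=h(\psi)e^{i\psi}+h'(\psi)e^{i(\psi+\pi/2)}$ parametrizes $\Gamma$, where $\psi$ is the angle of the outer normal at $z(\psi)$. An oriented line $\cos\varphi\cdot x+\sin\varphi\cdot y=\lambda$ has coordinates $(\varphi,\lambda)\in\mathbb A=\mathbb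 T\times\mathbb R$, where $\varphi$ is the direction of its right normal. The lines meeting the interior of $\Gamma$ form $\mathbb A_\Gamma=\{(\varphi,\lambda):-h(\varphi+\pi)<\lambda<h(\varphi)\}$. The billiard map $f:\mathbb A_\Gamma\to\mathbb A_\Gamma$ sends an oriented line to its reflection with respect to the tangent to $\Gamma$ at the second intersection of the line with $\Gamma$. Equivalently, with $\psi=(\varphi_1+\varphi)/2$, $\theta=(\varphi_1-\varphi)/2\in(0,\pi)$: $f(\varphi,\lambda)=(\varphi_1,\lambda_1)$ iff $\lambda=h(\psi)\cos\theta-h'(\psi)\sin\theta$ and $\lambda_1=h(\psi)\cos\theta+h'(\psi)\sin\theta$. A caustic is a curve such that any billiard trajectory, once tangent to it, stays tangent after every reflection. A convex caustic is $p/q$-resonant when all its (counterclockwise oriented) tangent trajectories form closed polygons with $q$ sides making $p$ turns around it. For the unit circle it is the concentric circle of radius $\cos(\pi p/q)$. Deformations. A deformation $\Gamma_\epsilon$, $\epsilon\in[-\epsilon_0,\epsilon_0]$, of the unit circle is given by a support function $h(\psi;\epsilon)=h_\epsilon(\psi)$, smooth in $(\psi,\epsilon)$, with $h(\psi;\epsilon)\asymp1+\sum_{k\ge1}\epsilon^kh_k(\psi)$; $\epsilon_0>0$ is small enough, and $f_\epsilon$ is the billiard map in $\Gamma_\epsilon$. Let $T_n[\psi]$ be the space of $2\pi$-periodic real trigonometric polynomials of degree $\le n$ in $\psi$. The deformation is polynomial of degree $\le n$ when $h_k(\psi)\in T_{nk}[\psi]$ for all $k\ge1$. It is centrally symmetric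 when $h_\epsilon(\psi+\pi)=h_\epsilon(\psi)$, and anti-centrally symmetric when $h_\epsilon(\psi+\pi)=h_{-\epsilon}(\psi)$. Operators. $\omega=2\pi p/q$; acting on functions of $t$ (and possibly $\epsilon$): $\tau\{a\}(t)=a(t+\omega)$, $\sigma\{a\}=\tau\{a\}+a$, $\delta\{a\}=\tau\{a\}-a$, $\mu\{a\}(t)=\frac1q\sum_{j=0}^{q-1}a(t+j\omega)$. A prime denotes the derivative with respect to $\psi$ or $t$; $h\circ\psi$ denotes $h(\psi(t;\epsilon);\epsilon)$, and similarly for $h'\circ\psi$. Persistence. For $m\in\mathbb N\cup\{0\}$ the $p/q$-resonant caustic $\mathrm O(\epsilon^m)$-persists under $\Gamma_\epsilon$ iff the following three conditions hold. (F)$_m$ There are smooth functions $\varphi(t;\epsilon),\psi(t;\epsilon),\theta(t;\epsilon)$ with $\varphi-t$, $\psi-t$, $\theta$ $2\pi$-periodic in $t$, related by $\psi=\varphi+\theta=\sigma\{\varphi\}/2$, $2\theta=\delta\{\varphi\}$, $\mu\{\psi-t\}=0$, $\mu\{t-\varphi\}=\omega/2=\mu\{\theta\}$, such that $\varphi'(t;\epsilon)>0$ and $\sigma\{h'\circ\psi\cdot\sin\theta\}-\delta\{h\circ\psi\cdot\cos\theta\}=\mathrm O(\epsilon^{m+1})$ as $\epsilon\to0$. (P)$_m$ There are smooth parametrizations $c_\epsilon:\mathbb T\to\mathbb A_{\Gamma_\epsilon}$, $c_\epsilon(t)=(\varphi(t;\epsilon),\lambda(t;\epsilon))$, of graphs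 $G_\epsilon=c_\epsilon(\mathbb T)$ such that $f_\epsilon\circ c_\epsilon-\tau\{c_\epsilon\}=(0,\mathrm O(\epsilon^{m+1}))$ as $\epsilon\to0$. (A)$_m$ There is $L(\epsilon)>0$ such that $A_\epsilon\{\varphi\}:=2q\,\mu\{h\circ\psi\cdot\sin\theta\}$ satisfies $A_\epsilon\{\varphi\}-L(\epsilon)=\mathrm O(\epsilon^{m+1})$ as $\epsilon\to0$. *)

(* Defs.v *)
From Stdlib Require Import Reals ZArith Arith.
From Coquelicot Require Import Coquelicot.
Open Scope R_scope.

(* Stdlib reals with Coquelicot.  A function on T = R/2piZ is a 2pi-periodic
   function on R, and a point of T is given by any of its lifts.  A family
   a(t;eps) is a function a : R -> R -> R, with t the first argument. *)

Definition slice (a : R -> R -> R) (e : R) : R -> R := fun t => a t e.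

Definition periodic (a : R -> R) : Prop := forall t, a (t + 2 * PI) = a t.

(** * Smooth families and asymptotics *)

(* f is C^k on R x [-e0,e0]: for k > 0, both partial derivatives exist on the
   strip and are C^(k-1).  The derivative in eps is taken within [-e0,e0], so it
   is one-sided at the end points. *)
Fixpoint Ck (k : nat) (e0 : R) (f : R -> R -> R) : Prop :=
  continuous_on (fun x : R * R => Rabs (snd x) <= e0)
                (fun x : R * R => f (fst x) (snd x)) /\
  match k with
  | O => True
  | S k' =>
      exists ft fe : R -> R -> R,
        (forall t e, Rabs e <= e0 -> is_derive (slice f e) t (ft t e)) /\
        (forall t e, Rabs e <= e0 ->
           filterdiff (f t) (within (fun e' => Rabs e' <= e0) (locally e))
                      (fun y : R => scal y (fe t e))) /\
        Ck k' e0 ft /\ Ck k' e0 fe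
  end.

Definition smooth (e0 : R) (f : R -> R -> R) : Prop := forall k, Ck k e0 f.

(* F(t;eps) = O(eps^k) as eps -> 0, uniformly in t. *)
Definition O_eps (k : nat) (F : R -> R -> R) : Prop :=
  exists K : R,
    locally 0 (fun e => forall t, Rabs (F t e) <= K * Rabs e ^ k).

Definition asymp_expansion (h : R -> R -> R) (hk : nat -> R -> R) : Prop :=
  forall N : nat,
    O_eps (S N) (fun s e =>
      h s e - (1 + sum_n_m (fun k => e ^ k * hk k s) 1 N)).

(** * Convex curves and billiards *)

Definition cis (x : R) : C := (cos x, sin x).

(* Strict convexity of the smooth curve amounts to a positive radius of
   curvature h + h''. *)
Definition convex_support (h : R -> R) : Prop :=
  periodic h /\ (forall s, 0 < h s) /\ (forall s, 0 < h s + Derive_n h 2 s).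

Definition curve (h : R -> R) (s : R) : C :=
  (RtoC (h s) * cis s + RtoC (Derive h s) * cis (s + PI / 2))%C.

(* The oriented line of coordinates c = (phi,lambda). *)
Definition on_line (c : R * R) (z : C) : Prop :=
  cos (fst c) * Re z + sin (fst c) * Im z = snd c.

Definition line_dir (c : R * R) : C := cis (fst c + PI / 2).

(* The phase space of lines meeting the interior. *)
Definition in_A (h : R -> R) (c : R * R) : Prop :=
  - h (fst c + PI) < snd c < h (fst c).

(* The line meets the curve at curve h s, after having met it at curve h s'. *)
Definition second_intersection (h : R -> R) (c : R * R) (s : R) : Prop :=
  on_line c (curve h s) /\
  exists s' r : R,
    0 < r /\ curve h s = (curve h s' + RtoC r * line_dir c)%C.

(* Reflection in the tangent at curve h s, whose direction is
   u = cis (s + pi/2), acts on directions as d |-> u^2 * conj d. *)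
Definition reflected_line (h : R -> R) (s : R) (c c1 : R * R) : Prop :=
  on_line c1 (curve h s) /\
  line_dir c1 =
    (cis (s + PI / 2) * cis (s + PI / 2) * Cconj (line_dir c))%C.

(* The graph of the billiard map: c1 represents the image of c.  The first
   component of c1 is determined modulo 2pi, the second one uniquely. *)
Definition billiard_map (h : R -> R) (c c1 : R * R) : Prop :=
  in_A h c /\
  exists s : R, second_intersection h c s /\ reflected_line h s c c1.

(** * Deformations of the unit circle *)

Definition deformation (e0 : R) (h : R -> R -> R) (hk : nat -> R -> R) : Prop :=
  0 < e0 /\
  smooth e0 h /\
  (forall e, Rabs e <= e0 -> convex_support (slice h e)) /\
  asymp_expansion h hk.

(* The space T_d of real trigonometric polynomials of degree at most d. *)
Definition trig_poly (d : nat) (g : R -> R) : Prop :=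
  exists a b : nat -> R,
    forall s, g s = sum_n (fun j => a j * cos (INR j * s) + b j * sin (INR j * s)) d.

Definition polynomial_deformation
    (e0 : R) (h : R -> R -> R) (n : nat) : Prop :=
  exists hk : nat -> R -> R,
    deformation e0 h hk /\
    forall k : nat, (1 <= k)%nat -> trig_poly (n * k) (hk k).

Definition centrally_symmetric (e0 : R) (h : R -> R -> R) : Prop :=
  forall s e, Rabs e <= e0 -> h (s + PI) e = h s e.

Definition anti_centrally_symmetric (e0 : R) (h : R -> R -> R) : Prop :=
  forall s e, Rabs e <= e0 -> h (s + PI) e = h s (- e).

(** * Persistence of resonant caustics *)

Definition tau (w : R) (a : R -> R) (t : R) : R := a (t + w).
Definition sigma (w : R) (a : R -> R) (t : R) : R := tau w a t + a t.
Definition delta (w : R) (a : R -> R) (t : R) : R := tau w a t - a t.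
Definition mu (q : nat) (w : R) (a : R -> R) (t : R) : R :=
  / INR q * sum_n (fun j => a (t + INR j * w)) (pred q).

Definition omega (p q : nat) : R := 2 * PI * INR p / INR q.

Definition condition_F (e1 : R) (h : R -> R -> R) (p q m : nat)
    (phi psi theta : R -> R -> R) : Prop :=
  let w := omega p q in
  smooth e1 phi /\ smooth e1 psi /\ smooth e1 theta /\
  (forall e, Rabs e <= e1 ->
     periodic (fun t => phi t e - t) /\
     periodic (fun t => psi t e - t) /\
     periodic (slice theta e) /\
     forall t,
       psi t e = phi t e + theta t e /\
       psi t e = sigma w (slice phi e) t / 2 /\
       2 * theta t e = delta w (slice phi e) t /\
       mu q w (fun s => psi s e - s) t = 0 /\
       mu q w (fun s => s - phi s e) t = w / 2 /\
       mu q w (slice theta e) t = w / 2 /\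
       0 < Derive (slice phi e) t) /\
  O_eps (S m) (fun t e =>
    sigma w (fun s => Derive (slice h e) (psi s e) * sin (theta s e)) t
    - delta w (fun s => h (psi s e) e * cos (theta s e)) t).

(* c_eps(t) = (phi(t;eps), lambda(t;eps)).  Since phi - t is periodic, the lift
   to R x R of c_eps(T) is the set of all points (phi t e, lambda t e), t in R.
   The image f_eps (c_eps(t)) is (phi (t + w) e, lambda1 t e): its first
   component agrees with that of tau{c_eps} in T, the second one up to the
   error. *)
Definition condition_P (e1 : R) (h : R -> R -> R) (p q m : nat)
    (phi : R -> R -> R) : Prop :=
  let w := omega p q in
  exists lambda lambda1 : R -> R -> R,
    smooth e1 phi /\ smooth e1 lambda /\
    (forall e, Rabs e <= e1 ->
       periodic (fun t => phi t e - t) /\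
       periodic (slice lambda e) /\
       (forall t, in_A (slice h e) (phi t e, lambda t e)) /\
       (forall x, exists! y, exists t, phi t e = x /\ lambda t e = y) /\
       (forall t, billiard_map (slice h e) (phi t e, lambda t e)
                               (phi (t + w) e, lambda1 t e))) /\
    O_eps (S m) (fun t e => lambda1 t e - tau w (slice lambda e) t).

Definition condition_A (e1 : R) (h : R -> R -> R) (p q m : nat)
    (psi theta : R -> R -> R) : Prop :=
  let w := omega p q in
  exists L : R -> R,
    (forall e, Rabs e <= e1 -> 0 < L e) /\
    O_eps (S m) (fun t e =>
      2 * INR q * mu q w (fun s => h (psi s e) e * sin (theta s e)) t - L e).

(* The p/q-resonant caustic O(eps^m)-persists.  The functions phi, psi, theta
   are common to the three conditions, which hold for |eps| <= e1: the range
   of eps may be shrunk. *)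
Definition persists (e0 : R) (h : R -> R -> R) (p q m : nat) : Prop :=
  exists e1 : R, 0 < e1 <= e0 /\
    exists phi psi theta : R -> R -> R,
      condition_F e1 h p q m phi psi theta /\
      condition_P e1 h p q m phi /\
      condition_A e1 h p q m psi theta.

(* The value chi(Gamma_eps,q).  A deformation may be both centrally and
   anti-centrally symmetric; then every applicable formula is a value. *)
Inductive is_chi (e0 : R) (h : R -> R -> R) (n q : nat) : Z -> Prop :=
| chi_anti_odd :
    anti_centrally_symmetric e0 h -> Nat.Odd q ->
    is_chi e0 h n q (1 + 2 * Zceil ((INR q - INR n) / (2 * INR n)))
| chi_anti_even :
    anti_centrally_symmetric e0 h -> Nat.Even q ->
    is_chi e0 h n q (2 * Zceil (INR q / (2 * INR n)))
| chi_central_odd :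
    centrally_symmetric e0 h -> Nat.Odd q ->
    is_chi e0 h n q (Zceil (2 * INR q / INR n))
| chi_otherwise :
    ~ anti_centrally_symmetric e0 h ->
    ~ (centrally_symmetric e0 h /\ Nat.Odd q) ->
    is_chi e0 h n q (Zceil (INR q / INR n)).

(* Main.v *)
Require Import Defs.
From Stdlib Require Import Reals ZArith Arith Lra Lia FunctionalExtensionality.
From Coquelicot Require Import Coquelicot.
Open Scope R_scope.

(* Write phi = t - w/2 + X with w = omega.  To first order at the circle, the
   equation of (F) is (sin (w/2) / 2) delta^2 X = given terms, so it can be solved
   order by order with X polynomial in eps and trigonometric in t, as long as no
   given term has a harmonic in qZ.  The coefficient of eps^k is a trigonometric
   polynomial of degree <= n k; when h_k is invariant (central symmetry), or
   multiplied by (-1)^k (anti-central symmetry), under s |-> s + pi, so is this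
   coefficient, and chi is the first order at which a nonzero multiple of q is
   allowed as a harmonic.  The harmonic 0 never obstructs: the sum over an orbit of
   phi'(t + w) times the defect at t is the derivative of the periodic function
   A_eps{phi}, hence vanishes somewhere.  The same identity yields (A) from (F). *)

(** * Families smooth on an open strip *)

(** The hypothesis controls [h] only in the uniform norm, order by order, whereas the equation of
    (F) also contains h'. An expansion of h' is recovered by interpolating between [h] and h'',
    which costs half of the order; this is harmless because every order is available. Only finitely
    many orders are solved, so X is a finite sum and no convergence enters. The base point of the
    linearization can stay the circle at every order, because h - 1, h' and X are all O(eps). The
    formulas for chi come from counting parities. With anti-central symmetry, the coefficient of
    eps^k has only harmonics of the parity of k: for odd q, an odd k is obstructed once n k >= q,
    but an even k only once n k >= 2 q; for even q, only even k can be obstructed. With central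
    symmetry all harmonics are even, so an odd q is first met through 2 q. *)

Fixpoint Cstrip (k : nat) (r : R) (f : R -> R -> R) : Prop :=
  (forall t e, Rabs e < r ->
     continuous (fun x : R * R => f (fst x) (snd x)) (t, e)) /\
  match k with
  | O => True
  | S k' =>
      exists ft fe : R -> R -> R,
        (forall t e, Rabs e < r -> is_derive (slice f e) t (ft t e)) /\
        (forall t e, Rabs e < r -> is_derive (f t) e (fe t e)) /\
        Cstrip k' r ft /\ Cstrip k' r fe
  end.

Lemma Cstrip_continuous k r f : Cstrip k r f -> forall t e, Rabs e < r ->
  continuous (fun x : R * R => f (fst x) (snd x)) (t, e).
Proof. destruct k; intros H; apply H. Qed.

Lemma locally_strip r e : Rabs e < r -> locally e (fun e' => Rabs e' < r).
Proof.
  intros H. assert (Hp : 0 < r - Rabs e) by lra.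
  exists (mkposreal _ Hp). intros y Hy.
  unfold ball in Hy; simpl in Hy; unfold AbsRing_ball, abs, minus, plus, opp in Hy; simpl in Hy.
  replace y with ((y + - e) + e) by ring.
  eapply Rle_lt_trans; [apply Rabs_triang|lra].
Qed.

Lemma locally_strip2 r t e : Rabs e < r ->
  locally (t, e) (fun x : R * R => Rabs (snd x) < r).
Proof.
  intros H. destruct (locally_strip r e H) as [d Hd].
  exists d. intros [t' e'] [_ Hy]. apply Hd. exact Hy.
Qed.

Lemma Cstrip_ext k r f g : (forall t e, Rabs e < r -> f t e = g t e) ->
  Cstrip k r f -> Cstrip k r g.
Proof.
  assert (Hc : forall f g : R -> R -> R, (forall t e, Rabs e < r -> f t e = g t e) ->
    (forall t e, Rabs e < r ->
     continuous (fun x : R * R => f (fst x) (snd x)) (t, e)) ->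
    (forall t e, Rabs e < r ->
     continuous (fun x : R * R => g (fst x) (snd x)) (t, e))).
  { intros f' g' E H t e He. eapply continuous_ext_loc; [|apply H; exact He].
    generalize (locally_strip2 r t e He); apply filter_imp.
    intros x Hx. apply E, Hx. }
  intros E H. destruct k as [|k]; [split; [|exact I]|].
  - apply (Hc _ _ E), H.
  - destruct H as [H (ft & fe & H1 & H2 & H3 & H4)].
    split; [apply (Hc _ _ E), H|].
    exists ft, fe. split; [|split; [|split]]; try assumption.
    + intros t e He. eapply is_derive_ext; [|apply H1, He].
      intros s; apply E, He.
    + intros t e He. eapply is_derive_ext_loc; [|apply H2, He].
      generalize (locally_strip r e He); apply filter_imp. intros y Hy; apply E, Hy.
Qed.

Lemma Cstrip_S k r f : Cstrip (S k) r f -> Cstrip k r f.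
Proof.
  revert f; induction k as [|k IH]; intros f H.
  - split; [apply H|exact I].
  - destruct H as [H (ft & fe & H1 & H2 & H3 & H4)].
    split; [exact H|]. exists ft, fe. split; [|split; [|split]]; auto.
Qed.

Lemma Cstrip_const k r c : Cstrip k r (fun _ _ => c).
Proof.
  revert c; induction k as [|k IH]; intros c; (split; [intros; apply continuous_const|]).
  - exact I.
  - exists (fun _ _ => 0), (fun _ _ => 0); (split; [|split; [|split]]); auto; intros; apply @is_derive_const.
Qed.

Lemma Cstrip_t k r : Cstrip k r (fun t _ => t).
Proof.
  destruct k as [|k]; (split; [intros; apply continuous_fst|]).
  - exact I.
  - exists (fun _ _ => 1), (fun _ _ => 0); (split; [|split; [|split]]); try apply Cstrip_const; intros.
    + apply @is_derive_id. + apply @is_derive_const.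
Qed.

Lemma Cstrip_e k r : Cstrip k r (fun _ e => e).
Proof.
  destruct k as [|k]; (split; [intros; apply continuous_snd|]).
  - exact I.
  - exists (fun _ _ => 0), (fun _ _ => 1); (split; [|split; [|split]]); try apply Cstrip_const; intros.
    + apply @is_derive_const. + apply @is_derive_id.
Qed.

Lemma Cstrip_plus k r f g : Cstrip k r f -> Cstrip k r g ->
  Cstrip k r (fun t e => f t e + g t e).
Proof.
  revert f g; induction k as [|k IH]; intros f g [Hf Hf'] [Hg Hg'];
    (split; [intros; apply @continuous_plus; auto|]).
  - exact I.
  - destruct Hf' as (ft & fe & F1 & F2 & F3 & F4), Hg' as (gt & ge & G1 & G2 & G3 & G4).
    exists (fun t e => ft t e + gt t e), (fun t e => fe t e + ge t e); (split; [|split; [|split]]); auto; intros.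
    + apply (is_derive_plus (slice f e) (slice g e)); auto.
    + apply (is_derive_plus (f t) (g t)); auto.
Qed.

Lemma Cstrip_mult k r f g : Cstrip k r f -> Cstrip k r g ->
  Cstrip k r (fun t e => f t e * g t e).
Proof.
  revert f g; induction k as [|k IH]; intros f g Hf0 Hg0;
    pose proof Hf0 as [Hf Hf']; pose proof Hg0 as [Hg Hg'];
    (split; [intros; apply @continuous_mult; auto|]).
  - exact I.
  - destruct Hf' as (ft & fe & F1 & F2 & F3 & F4), Hg' as (gt & ge & G1 & G2 & G3 & G4).
    apply Cstrip_S in Hf0, Hg0.
    exists (fun t e => ft t e * g t e + f t e * gt t e),
           (fun t e => fe t e * g t e + f t e * ge t e); (split; [|split; [|split]]); auto; intros.
    + apply (is_derive_mult (slice f e) (slice g e)); auto. intros; apply Rmult_comm.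
    + apply (is_derive_mult (f t) (g t)); auto. intros; apply Rmult_comm.
    + apply Cstrip_plus; apply IH; auto.
    + apply Cstrip_plus; apply IH; auto.
Qed.

Lemma Cstrip_comp k r f psi : Cstrip k r f -> Cstrip k r psi ->
  Cstrip k r (fun t e => f (psi t e) e).
Proof.
  revert f psi; induction k as [|k IH]; intros f psi Hf0 Hp0;
    pose proof Hf0 as [Hf Hf']; pose proof Hp0 as [Hp Hp'];
    (split; [intros t e He;
       apply (continuous_comp_2 (fun x : R * R => psi (fst x) (snd x)) (fun x => snd x));
       [apply Hp, He | apply continuous_snd | apply Hf, He]|]).
  - exact I.
  - destruct Hf' as (ft & fe & F1 & F2 & F3 & F4), Hp' as (pt & pe & P1 & P2 & P3 & P4).
    apply Cstrip_S in Hf0, Hp0.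
    exists (fun t e => ft (psi t e) e * pt t e),
           (fun t e => ft (psi t e) e * pe t e + fe (psi t e) e); (split; [|split; [|split]]); auto; intros.
    + replace (ft (psi t e) e * pt t e) with (scal (pt t e) (ft (psi t e) e))
        by apply Rmult_comm.
      apply (is_derive_comp (slice f e) (slice psi e)); auto; apply F1; auto.
    + apply is_derive_Reals.
      replace (ft (psi t e) e * pe t e + fe (psi t e) e)
        with (ft (psi t e) e * pe t e + fe (psi t e) e * 1) by ring.
      (* The chain rule along (psi t e, e) needs joint differentiability of [f]. It follows from the
         eps-derivative at the point and the continuity of [ft] there. *)
      apply (derivable_pt_lim_comp_2d f (psi t) (fun e => e)).
      * apply filterdiff_differentiable_pt_lim.
        eapply filterdiff_ext_lin;
          [apply (is_derive_filterdiff f (psi t e) e ft (fe (psi t e) e))|].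
        -- generalize (locally_strip2 r (psi t e) e H); apply filter_imp.
           intros x Hx; apply F1, Hx.
        -- apply F2, H.
        -- apply (Cstrip_continuous _ _ _ F3), H.
        -- intros y; reflexivity.
      * apply is_derive_Reals, P2, H.
      * apply is_derive_Reals, @is_derive_id.
    + apply Cstrip_mult; auto.
    + apply Cstrip_plus; auto. apply Cstrip_mult; auto.
Qed.

Lemma Cstrip_opp k r f : Cstrip k r f -> Cstrip k r (fun t e => - f t e).
Proof.
  intros H. apply Cstrip_ext with (fun t e => (-1) * f t e); [intros; ring|].
  apply Cstrip_mult; [apply Cstrip_const|exact H].
Qed.

Lemma Cstrip_minus k r f g : Cstrip k r f -> Cstrip k r g ->
  Cstrip k r (fun t e => f t e - g t e).
Proof. intros Hf Hg. apply Cstrip_plus, Cstrip_opp; assumption. Qed.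

Lemma Cstrip_pow k r i : Cstrip k r (fun _ e => e ^ i).
Proof.
  induction i as [|i IH]; simpl; [apply Cstrip_const|].
  apply Cstrip_mult; [apply Cstrip_e|exact IH].
Qed.

Lemma Cstrip_sin_cos k r : Cstrip k r (fun t _ => sin t) /\ Cstrip k r (fun t _ => cos t).
Proof.
  induction k as [|k [IHs IHc]]; (split; split; [|try exact I| |try exact I]); try (intros t e _;
    apply (continuous_comp (fun x : R * R => fst x)); [apply continuous_fst|];
    first [apply continuous_sin | apply continuous_cos]).
  - exists (fun t _ => cos t), (fun _ _ => 0); (split; [|split; [|split]]); auto; intros.
    + apply is_derive_sin. + apply @is_derive_const. + apply Cstrip_const.
  - exists (fun t _ => - sin t), (fun _ _ => 0); (split; [|split; [|split]]); auto; intros.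
    + apply is_derive_cos. + apply @is_derive_const. + apply Cstrip_opp, IHs. + apply Cstrip_const.
Qed.

Lemma Cstrip_sin k r f : Cstrip k r f -> Cstrip k r (fun t e => sin (f t e)).
Proof. apply (Cstrip_comp k r (fun t _ => sin t)), Cstrip_sin_cos. Qed.

Lemma Cstrip_cos k r f : Cstrip k r f -> Cstrip k r (fun t e => cos (f t e)).
Proof. apply (Cstrip_comp k r (fun t _ => cos t)), Cstrip_sin_cos. Qed.

Lemma Cstrip_Derive k r f : Cstrip (S k) r f ->
  Cstrip k r (fun t e => Derive (slice f e) t).
Proof.
  intros [_ (ft & fe & H1 & _ & H3 & _)]. eapply Cstrip_ext; [|exact H3].
  intros t e He. symmetry. apply is_derive_unique, H1, He.
Qed.

(** At interior points the condition |e'| <= r holds nearby, so the one-sided derivatives of [Ck]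
    are ordinary ones. All the calculus is done on the open strip, with two-sided derivatives, and
    [Cstrip_Ck] returns to a closed strip that is strictly smaller. *)
Lemma Ck_Cstrip k r f : Ck k r f -> Cstrip k r f.
Proof.
  assert (Hc : forall f : R -> R -> R, continuous_on (fun x : R * R => Rabs (snd x) <= r)
                (fun x : R * R => f (fst x) (snd x)) ->
    forall t e, Rabs e < r -> continuous (fun x : R * R => f (fst x) (snd x)) (t, e)).
  { intros g H t e He. eapply continuous_continuous_on; [|exact H].
    generalize (locally_strip2 r t e He); apply filter_imp. intros; lra. }
  revert f; induction k as [|k IH]; intros f [H H']; (split; [apply Hc, H|]).
  - exact I.
  - destruct H' as (ft & fe & H1 & H2 & H3 & H4).
    exists ft, fe; (split; [|split; [|split]]); auto.
    + intros; apply H1; lra.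
    + intros t e He.
      pose proof (H2 t e (Rlt_le _ _ He)) as [L D].
      split; [apply is_linear_scal_l|].
      intros x Hx eps. assert (e = x) as <- by exact (is_filter_lim_locally_unique (V := R_NormedModule) e x Hx).
      assert (Q : is_filter_lim (within (fun e' => Rabs e' <= r) (locally e)) e).
      { intros P HP. unfold within. revert HP; apply filter_imp. auto. }
      generalize (filter_and _ _ (locally_strip r e He) (D e Q eps)). apply filter_imp.
      intros y [Hy1 Hy2]. apply Hy2. lra.
Qed.

Lemma Cstrip_Ck k r r' f : r' < r -> Cstrip k r f -> Ck k r' f.
Proof.
  intros Hr. revert f; induction k as [|k IH]; intros f [H H'];
    (split; [intros [t e] He; simpl in He|]).
  - intros P HP. pose proof (H t e (Rle_lt_trans _ _ _ He Hr) P HP) as Q.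
    unfold filtermap, within in *; revert Q; apply filter_imp; auto.
  - exact I.
  - intros P HP. pose proof (H t e (Rle_lt_trans _ _ _ He Hr) P HP) as Q.
    unfold filtermap, within in *; revert Q; apply filter_imp; auto.
  - destruct H' as (ft & fe & H1 & H2 & H3 & H4).
    exists ft, fe; (split; [|split; [|split]]); auto.
    + intros; apply H1; lra.
    + intros t e He.
      (* Properness holds because e itself lies in the closed interval. *)
      assert (ProperFilter (within (fun e' => Rabs e' <= r') (locally e))).
      { split; [|apply within_filter, locally_filter].
        intros P [d Hd]. exists e. apply (Hd e); [apply ball_center|exact He]. }
      apply (filterdiff_locally _ e).
      * intros P HP. unfold within. revert HP; apply filter_imp. auto.
      * apply (H2 t e); lra.
Qed.

(** * Families of order O(eps^k) *)

Lemma locally_0_Rabs_lt (r : R) : 0 < r -> locally 0 (fun e => Rabs e < r).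
Proof. intros H. apply locally_strip. rewrite Rabs_R0. exact H. Qed.

Lemma O_eps_dom k C F G :
  locally 0 (fun e => forall t, Rabs (F t e) <= C * Rabs (G t e)) -> O_eps k G -> O_eps k F.
Proof.
  intros H [K HK]. exists (Rabs C * K).
  generalize (filter_and _ _ H HK); apply filter_imp. intros e [H1 H2] t.
  specialize (H1 t); specialize (H2 t).
  pose proof (Rle_abs C). pose proof (Rabs_pos C). pose proof (Rabs_pos (G t e)).
  nra.
Qed.

Lemma O_eps_ext_loc k F G :
  locally 0 (fun e => forall t, F t e = G t e) -> O_eps k G -> O_eps k F.
Proof.
  intros H. apply (O_eps_dom k 1). revert H; apply filter_imp.
  intros e H t. rewrite H. lra.
Qed.

Lemma O_eps_ext k F G : (forall t e, F t e = G t e) -> O_eps k G -> O_eps k F.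
Proof. intros H. apply O_eps_ext_loc, filter_forall. auto. Qed.

Lemma O_eps_mult j k F G : O_eps j F -> O_eps k G ->
  O_eps (j + k) (fun t e => F t e * G t e).
Proof.
  intros [K HK] [L HL]. exists (K * L).
  generalize (filter_and _ _ HK HL); apply filter_imp. intros e [H1 H2] t.
  rewrite Rabs_mult, pow_add.
  replace (K * L * _) with ((K * Rabs e ^ j) * (L * Rabs e ^ k)) by ring.
  apply Rmult_le_compat; auto using Rabs_pos.
Qed.

Lemma O_eps_plus k F G : O_eps k F -> O_eps k G -> O_eps k (fun t e => F t e + G t e).
Proof.
  intros [K HK] [L HL]. exists (K + L).
  generalize (filter_and _ _ HK HL); apply filter_imp. intros e [H1 H2] t.
  eapply Rle_trans; [apply Rabs_triang|]. specialize (H1 t); specialize (H2 t). lra.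
Qed.

Lemma O_eps_scal k c F : O_eps k F -> O_eps k (fun t e => c * F t e).
Proof.
  apply (O_eps_dom k (Rabs c)), filter_forall. intros e t. rewrite Rabs_mult. lra.
Qed.

Lemma O_eps_opp k F : O_eps k F -> O_eps k (fun t e => - F t e).
Proof.
  intros H. apply (O_eps_ext k _ (fun t e => (-1) * F t e)); [intros; ring|].
  apply O_eps_scal, H.
Qed.

Lemma O_eps_minus k F G : O_eps k F -> O_eps k G -> O_eps k (fun t e => F t e - G t e).
Proof. intros HF HG. apply O_eps_plus, O_eps_opp; assumption. Qed.

Lemma O_eps_trans k F G H :
  O_eps k (fun t e => F t e - G t e) -> O_eps k (fun t e => G t e - H t e) ->
  O_eps k (fun t e => F t e - H t e).
Proof.
  intros H1 H2. eapply O_eps_ext; [|exact (O_eps_plus _ _ _ H1 H2)].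
  intros; simpl; ring.
Qed.

Lemma O_eps_near k F G :
  O_eps k G -> O_eps k (fun t e => F t e - G t e) -> O_eps k F.
Proof.
  intros H1 H2. eapply O_eps_ext; [|exact (O_eps_plus _ _ _ H1 H2)].
  intros; simpl; ring.
Qed.

Lemma O_eps_bounded F K : (forall t e, Rabs (F t e) <= K) -> O_eps 0 F.
Proof. intros H. exists K. apply filter_forall. intros e t. simpl. rewrite Rmult_1_r. apply H. Qed.

Lemma O_eps_zero k : O_eps k (fun _ _ => 0).
Proof. exists 0. apply filter_forall. intros e t. rewrite Rabs_R0. lra. Qed.

Lemma O_eps_pow k : O_eps k (fun _ e => e ^ k).
Proof. exists 1. apply filter_forall. intros e t. rewrite RPow_abs. lra. Qed.

Lemma O_eps_pow_mult k i F : O_eps i F -> O_eps (k + i) (fun t e => e ^ k * F t e).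
Proof. apply O_eps_mult, O_eps_pow. Qed.

Lemma O_eps_le j k F : (k <= j)%nat -> O_eps j F -> O_eps k F.
Proof.
  intros Hjk [K HK]. exists (Rabs K).
  generalize (filter_and _ _ HK (locally_0_Rabs_lt 1 Rlt_0_1)); apply filter_imp.
  intros e [H1 H2] t. eapply Rle_trans; [apply H1|].
  replace j with (k + (j - k))%nat by lia. rewrite pow_add.
  assert (Rabs e ^ (j - k) <= 1).
  { rewrite <- (pow1 (j - k)). apply pow_incr. split; [apply Rabs_pos|lra]. }
  pose proof (pow_le (Rabs e) k (Rabs_pos e)). pose proof (pow_le (Rabs e) (j - k) (Rabs_pos e)).
  pose proof (Rle_abs K). pose proof (Rabs_pos K).
  rewrite <- Rmult_assoc. apply Rle_trans with (Rabs K * Rabs e ^ k * Rabs e ^ (j - k)).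
  - apply Rmult_le_compat_r; [lra|]. apply Rmult_le_compat_r; lra.
  - rewrite <- (Rmult_1_r (Rabs K * Rabs e ^ k)) at 2. apply Rmult_le_compat_l; [nra|lra].
Qed.

Lemma O_eps_comp k F (s : R -> R -> R) : O_eps k F -> O_eps k (fun t e => F (s t e) e).
Proof. intros [K HK]. exists K. revert HK; apply filter_imp. intros e H t. apply H. Qed.

Lemma O_eps_pow_bounded k (a : R -> R) :
  (exists K, forall t, Rabs (a t) <= K) -> O_eps k (fun t e => e ^ k * a t).
Proof.
  intros [K HK]. rewrite <- (Nat.add_0_r k) at 1.
  apply (O_eps_pow_mult k 0 (fun t _ => a t)), (O_eps_bounded _ K). intros; apply HK.
Qed.

Lemma O_eps_small F d : O_eps 1 F -> 0 < d ->
  locally 0 (fun e => forall t, Rabs (F t e) < d).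
Proof.
  intros [K HK] Hd.
  assert (Hp : 0 < d / (Rabs K + 1)) by (apply Rdiv_lt_0_compat; [lra|pose proof (Rabs_pos K); lra]).
  generalize (filter_and _ _ HK (locally_0_Rabs_lt _ Hp)); apply filter_imp.
  intros e [H1 H2] t. eapply Rle_lt_trans; [apply H1|].
  rewrite pow_1. pose proof (Rabs_pos K). pose proof (Rle_abs K). pose proof (Rabs_pos e).
  apply Rle_lt_trans with ((Rabs K + 1) * Rabs e); [nra|].
  replace d with ((Rabs K + 1) * (d / (Rabs K + 1))) by (field; lra).
  apply Rmult_lt_compat_l; lra.
Qed.

Lemma O_eps_pow_const k c : O_eps (S k) (fun _ e => c * e ^ k) -> c = 0.
Proof.
  intros [K [d HK]]. destruct (Req_dec c 0) as [|Hc]; [assumption|exfalso].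
  apply Rabs_pos_lt in Hc. pose proof (Rabs_pos K).
  (* Small enough that the bound at e = x would give |c| x^k <= (|c| / 2) x^k. *)
  set (x := Rmin (d / 2) (Rabs c / (2 * (Rabs K + 1)))).
  assert (Hx : 0 < x).
  { apply Rmin_pos; [pose proof (cond_pos d); lra|]. apply Rdiv_lt_0_compat; lra. }
  assert (Hxd : x < d) by (pose proof (Rmin_l (d / 2) (Rabs c / (2 * (Rabs K + 1))));
    pose proof (cond_pos d); unfold x in *; lra).
  assert (Hxc : (Rabs K + 1) * x <= Rabs c / 2).
  { replace (Rabs c / 2) with ((Rabs K + 1) * (Rabs c / (2 * (Rabs K + 1)))) by (field; lra).
    apply Rmult_le_compat_l; [lra|apply Rmin_r]. }
  specialize (HK x). refine (_ (HK _ 0)).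
  - rewrite Rabs_mult, <- RPow_abs, (Rabs_pos_eq x) by lra. simpl.
    pose proof (pow_lt x k Hx). pose proof (Rle_abs K). intros Hle.
    assert (Rabs c * x ^ k <= Rabs c / 2 * x ^ k); [|nra].
    eapply Rle_trans; [exact Hle|]. rewrite <- Rmult_assoc.
    apply Rmult_le_compat_r; nra.
  - unfold ball; simpl; unfold AbsRing_ball, abs, minus, plus, opp; simpl.
    rewrite Ropp_0, Rplus_0_r, Rabs_pos_eq; lra.
Qed.

(** Uniqueness of asymptotic expansions. Once the coefficients below i vanish, e^i a_i is the whole
    sum minus a tail divisible by e^(i+1). *)
Lemma O_eps_coefficients N (a : nat -> R -> R) :
  O_eps N (fun t e => sum_n (fun i => e ^ i * a i t) N) ->
  forall i, (i < N)%nat -> forall t, a i t = 0.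
Proof.
  intros H i. induction i as [i IH] using lt_wf_ind. intros Hi t.
  apply (O_eps_pow_const i).
  apply O_eps_ext with (fun _ e => sum_n (fun i => e ^ i * a i t) N
     - e ^ S i * sum_n_m (fun l => e ^ (l - S i) * a l t) (S i) N).
  - intros _ e. unfold sum_n. rewrite (sum_n_m_Chasles _ 0 i N) by lia.
    destruct i as [|i].
    + rewrite sum_n_n. change plus with Rplus.
      match goal with |- _ = ?A + ?B - ?C => replace B with C; [simpl; ring|] end.
      rewrite <- (sum_n_m_mult_l (K := R_Ring)). apply sum_n_m_ext_loc. intros l Hl.
      change mult with Rmult. rewrite <- Rmult_assoc, <- pow_add. do 2 f_equal. lia.
    + rewrite sum_n_Sm by lia.
      rewrite (sum_n_m_ext_loc _ (fun _ => 0) 0 i).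
      2: { intros l Hl. rewrite (IH l) by lia. apply Rmult_0_r. }
      rewrite sum_n_m_const, Rmult_0_r. change plus with Rplus.
      match goal with |- _ = _ + ?A + ?B - ?C => replace B with C; [ring|] end.
      rewrite <- (sum_n_m_mult_l (K := R_Ring)). apply sum_n_m_ext_loc. intros l Hl.
      change mult with Rmult. rewrite <- Rmult_assoc, <- pow_add. do 2 f_equal. lia.
  - apply O_eps_minus.
    (* Freezing t makes the tail below bounded with no uniform bound on the coefficients. *)
    + apply (O_eps_le N); [lia|]. apply (O_eps_comp _ _ (fun _ _ => t) H).
    + rewrite <- (Nat.add_0_r (S i)) at 1. apply (O_eps_pow_mult (S i) 0).
      exists (sum_n_m (fun l => Rabs (a l t)) (S i) N).
      generalize (locally_0_Rabs_lt 1 Rlt_0_1); apply filter_imp. intros e He _.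
      simpl (_ ^ 0). rewrite Rmult_1_r.
      eapply Rle_trans; [apply (norm_sum_n_m (K := R_AbsRing) (V := R_NormedModule))|].
      apply sum_n_m_le. intros l. change norm with Rabs. rewrite Rabs_mult, <- RPow_abs.
      rewrite <- (Rmult_1_l (Rabs (a l t))) at 2. apply Rmult_le_compat_r; [apply Rabs_pos|].
      rewrite <- (pow1 (l - S i)). apply pow_incr. split; [apply Rabs_pos|lra].
Qed.

(** * Trigonometric polynomials with prescribed harmonics *)

(** Closure rules instead of coefficient sequences, so that shifts, products and derivatives are
    handled by induction. [tspan_ext] lets pointwise equal functions be exchanged. *)
Inductive tspan (P : nat -> Prop) : (R -> R) -> Prop :=
| tspan_zero : tspan P (fun _ => 0)
| tspan_cos l c : P l -> tspan P (fun t => c * cos (INR l * t))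
| tspan_sin l c : P l -> tspan P (fun t => c * sin (INR l * t))
| tspan_plus f g : tspan P f -> tspan P g -> tspan P (fun t => f t + g t)
| tspan_ext f g : (forall t, f t = g t) -> tspan P f -> tspan P g.

Lemma tspan_incl (P Q : nat -> Prop) f : (forall l, P l -> Q l) -> tspan P f -> tspan Q f.
Proof.
  intros H; induction 1; [apply tspan_zero|apply tspan_cos|apply tspan_sin|apply tspan_plus|
    eapply tspan_ext]; eauto.
Qed.

Lemma tspan_scal P c f : tspan P f -> tspan P (fun t => c * f t).
Proof.
  induction 1 as [|l d H|l d H|f g _ IHf _ IHg|f g E _ IH].
  - apply tspan_ext with (fun _ => 0); [intros; ring|apply tspan_zero].
  - apply tspan_ext with (fun t => c * d * cos (INR l * t)); [intros; ring|apply tspan_cos, H].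
  - apply tspan_ext with (fun t => c * d * sin (INR l * t)); [intros; ring|apply tspan_sin, H].
  - apply tspan_ext with (fun t => c * f t + c * g t); [intros; ring|apply tspan_plus; auto].
  - apply tspan_ext with (fun t => c * f t); [intros; now rewrite E|auto].
Qed.

Lemma tspan_const (P : nat -> Prop) c : P 0%nat -> tspan P (fun _ => c).
Proof.
  intros H. apply tspan_ext with (fun t => c * cos (INR 0 * t)); [|apply tspan_cos, H].
  intros t. simpl. rewrite Rmult_0_l, cos_0. ring.
Qed.

Lemma tspan_shift P s f : tspan P f -> tspan P (fun t => f (t + s)).
Proof.
  induction 1 as [|l d H|l d H|f g _ IHf _ IHg|f g E _ IH].
  - apply tspan_zero.
  - apply tspan_ext with (fun t => d * cos (INR l * s) * cos (INR l * t)
      + (- d * sin (INR l * s)) * sin (INR l * t)).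
    + intros t. rewrite Rmult_plus_distr_l, cos_plus. ring.
    + apply tspan_plus; [apply tspan_cos|apply tspan_sin]; exact H.
  - apply tspan_ext with (fun t => d * sin (INR l * s) * cos (INR l * t)
      + (d * cos (INR l * s)) * sin (INR l * t)).
    + intros t. rewrite Rmult_plus_distr_l, sin_plus. ring.
    + apply tspan_plus; [apply tspan_cos|apply tspan_sin]; exact H.
  - apply (tspan_plus P _ _ IHf IHg).
  - apply tspan_ext with (fun t => f (t + s)); auto.
Qed.

Lemma tspan_derive P f : tspan P f ->
  exists g, tspan P g /\ forall t, is_derive f t (g t).
Proof.
  induction 1 as [|l d H|l d H|f g _ [f' [Hf Df]] _ [g' [Hg Dg]]|f g E _ [f' [Hf Df]]].
  - exists (fun _ => 0). split; [apply tspan_zero|intros; apply @is_derive_const].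
  - exists (fun t => (- d * INR l) * sin (INR l * t)). split; [apply tspan_sin, H|].
    intros t. auto_derive; auto. ring.
  - exists (fun t => (d * INR l) * cos (INR l * t)). split; [apply tspan_cos, H|].
    intros t. auto_derive; auto. ring.
  - exists (fun t => f' t + g' t). split; [apply tspan_plus; auto|].
    intros t. apply (is_derive_plus f g); auto.
  - exists f'. split; [exact Hf|]. intros t. apply (is_derive_ext f); auto.
Qed.

Lemma tspan_bounded P f : tspan P f -> exists K, forall t, Rabs (f t) <= K.
Proof.
  induction 1 as [|l d H|l d H|f g _ [K HK] _ [L HL]|f g E _ [K HK]].
  - exists 0. intros; rewrite Rabs_R0; lra.
  - exists (Rabs d). intros t. rewrite Rabs_mult. rewrite <- (Rmult_1_r (Rabs d)) at 2.
    apply Rmult_le_compat_l; [apply Rabs_pos|apply Rabs_le, COS_bound].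
  - exists (Rabs d). intros t. rewrite Rabs_mult. rewrite <- (Rmult_1_r (Rabs d)) at 2.
    apply Rmult_le_compat_l; [apply Rabs_pos|apply Rabs_le, SIN_bound].
  - exists (K + L). intros t. eapply Rle_trans; [apply Rabs_triang|].
    specialize (HK t); specialize (HL t); lra.
  - exists K. intros t. rewrite <- E. apply HK.
Qed.

Lemma bounded_derive_lipschitz (f f' : R -> R) K :
  (forall t, is_derive f t (f' t)) -> (forall t, Rabs (f' t) <= K) ->
  forall s t, Rabs (f t - f s) <= K * Rabs (t - s).
Proof.
  intros D HK s t.
  destruct (MVT_gen f s t f') as [c [_ ->]].
  - intros; apply D.
  - intros x _. apply derivable_continuous_pt. exists (f' x). apply is_derive_Reals, D.
  - rewrite Rabs_mult. apply Rmult_le_compat_r; [apply Rabs_pos|apply HK].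
Qed.

Lemma tspan_lipschitz P f : tspan P f ->
  exists K, forall s t, Rabs (f t - f s) <= K * Rabs (t - s).
Proof.
  intros H. destruct (tspan_derive P f H) as [f' [H' D]].
  destruct (tspan_bounded P f' H') as [K HK].
  exists K. apply (bounded_derive_lipschitz f f' K D HK).
Qed.

Lemma tspan_periodic P f : tspan P f -> periodic f.
Proof.
  induction 1 as [|l d H|l d H|f g _ IHf _ IHg|f g E _ IH]; intros t.
  - reflexivity.
  - rewrite <- (cos_period (INR l * t) l). do 2 f_equal. ring.
  - rewrite <- (sin_period (INR l * t) l). do 2 f_equal. ring.
  - now rewrite IHf, IHg.
  - now rewrite <- !E, IH.
Qed.

(** Product-to-sum formulas. With truncated subtraction, [a - b + (b - a)] is |a - b|. *)
Lemma tspan_mult (P Q S : nat -> Prop) f g :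
  (forall a b, P a -> Q b -> S (a + b)%nat) ->
  (forall a b, P a -> Q b -> S (a - b + (b - a))%nat) ->
  tspan P f -> tspan Q g -> tspan S (fun t => f t * g t).
Proof.
  intros Hp Hm Hf Hg.
  assert (Hcos : forall a b t, cos (INR (a - b + (b - a)) * t) = cos (INR a * t - INR b * t)).
  { intros a b t. destruct (Nat.le_ge_cases a b) as [H|H].
    - replace (a - b + (b - a))%nat with (b - a)%nat by lia. rewrite minus_INR by exact H.
      rewrite <- cos_neg. f_equal. ring.
    - replace (a - b + (b - a))%nat with (a - b)%nat by lia. rewrite minus_INR by exact H.
      f_equal. ring. }
  assert (Hsin : forall a b, exists c, forall t,
    sin (INR a * t - INR b * t) = c * sin (INR (a - b + (b - a)) * t)).
  { intros a b. destruct (Nat.le_ge_cases a b) as [H|H].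
    - exists (-1). intros t.
      replace (a - b + (b - a))%nat with (b - a)%nat by lia. rewrite minus_INR by exact H.
      replace (INR a * t - INR b * t) with (- ((INR b - INR a) * t)) by ring.
      rewrite sin_neg. ring.
    - exists 1. intros t. replace (a - b + (b - a))%nat with (a - b)%nat by lia.
      rewrite minus_INR, Rmult_1_l by exact H. f_equal. ring. }
  assert (Hpl : forall a b t, INR (a + b) * t = INR a * t + INR b * t)
    by (intros; rewrite plus_INR; ring).
  induction Hf as [|a c Ha|a c Ha|f1 f2 _ IH1 _ IH2|f1 f2 E _ IH].
  - apply tspan_ext with (fun _ => 0); [intros; ring|apply tspan_zero].
  - induction Hg as [|b d Hb|b d Hb|g1 g2 _ IH1 _ IH2|g1 g2 E _ IH].
    + apply tspan_ext with (fun _ => 0); [intros; ring|apply tspan_zero].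
    + apply tspan_ext with (fun t => (c * d / 2) * cos (INR (a + b) * t)
        + (c * d / 2) * cos (INR (a - b + (b - a)) * t)).
      * intros t. rewrite Hcos, Hpl, cos_plus, cos_minus. field.
      * apply tspan_plus; apply tspan_cos; auto.
    + destruct (Hsin a b) as [s Hs].
      apply tspan_ext with (fun t => (c * d / 2) * sin (INR (a + b) * t)
        + (- c * d / 2 * s) * sin (INR (a - b + (b - a)) * t)).
      * intros t. rewrite (Rmult_assoc _ s), <- Hs, Hpl, sin_plus, sin_minus. field.
      * apply tspan_plus; apply tspan_sin; auto.
    + eapply tspan_ext; [|exact (tspan_plus _ _ _ IH1 IH2)]. intros; simpl; ring.
    + eapply tspan_ext; [|exact IH]. intros; simpl. now rewrite E.
  - induction Hg as [|b d Hb|b d Hb|g1 g2 _ IH1 _ IH2|g1 g2 E _ IH].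
    + apply tspan_ext with (fun _ => 0); [intros; ring|apply tspan_zero].
    + destruct (Hsin a b) as [s Hs].
      apply tspan_ext with (fun t => (c * d / 2) * sin (INR (a + b) * t)
        + (c * d / 2 * s) * sin (INR (a - b + (b - a)) * t)).
      * intros t. rewrite (Rmult_assoc _ s), <- Hs, Hpl, sin_plus, sin_minus. field.
      * apply tspan_plus; apply tspan_sin; auto.
    + apply tspan_ext with (fun t => (- c * d / 2) * cos (INR (a + b) * t)
        + (c * d / 2) * cos (INR (a - b + (b - a)) * t)).
      * intros t. rewrite Hcos, Hpl, cos_plus, cos_minus. field.
      * apply tspan_plus; apply tspan_cos; auto.
    + eapply tspan_ext; [|exact (tspan_plus _ _ _ IH1 IH2)]. intros; simpl; ring.
    + eapply tspan_ext; [|exact IH]. intros; simpl. now rewrite E.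
  - eapply tspan_ext; [|exact (tspan_plus _ _ _ IH1 IH2)]. intros; simpl; ring.
  - eapply tspan_ext; [|exact IH]. intros; simpl. now rewrite E.
Qed.

(* [cos (l (t - w))] is an eigenvector of the centred second difference, with
   eigenvalue [2 (cos (l w) - 1)]. *)
Lemma tspan_second_difference (P : nat -> Prop) w g :
  (forall l, P l -> cos (INR l * w) <> 1) -> tspan P g ->
  exists y, tspan P y /\ forall t, y (t + 2 * w) - 2 * y (t + w) + y t = g t.
Proof.
  intros Hw. induction 1 as [|l d H|l d H|f g _ [y [Hy Ey]] _ [z [Hz Ez]]|f g E _ [y [Hy Ey]]].
  - exists (fun _ => 0). split; [apply tspan_zero|intros; ring].
  - specialize (Hw l H).
    exists (fun t => d / (2 * (cos (INR l * w) - 1)) * cos (INR l * (t + - w))). split.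
    + apply (tspan_shift P (- w) (fun t => d / (2 * (cos (INR l * w) - 1)) * cos (INR l * t))).
      apply tspan_cos, H.
    + intros t. replace (t + 2 * w + - w) with (t + w) by ring.
      replace (t + w + - w) with t by ring.
      rewrite !Rmult_plus_distr_l, Ropp_mult_distr_r_reverse, !cos_plus, cos_neg, sin_neg.
      field. lra.
  - specialize (Hw l H).
    exists (fun t => d / (2 * (cos (INR l * w) - 1)) * sin (INR l * (t + - w))). split.
    + apply (tspan_shift P (- w) (fun t => d / (2 * (cos (INR l * w) - 1)) * sin (INR l * t))).
      apply tspan_sin, H.
    + intros t. replace (t + 2 * w + - w) with (t + w) by ring.
      replace (t + w + - w) with t by ring.
      rewrite !Rmult_plus_distr_l, Ropp_mult_distr_r_reverse, !sin_plus, cos_neg, sin_neg.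
      field. lra.
  - exists (fun t => y t + z t). split; [apply tspan_plus; auto|].
    intros t. rewrite <- Ey, <- Ez. ring.
  - exists y. split; [exact Hy|]. intros t. now rewrite <- E.
Qed.

Lemma tspan_split_constant (P : nat -> Prop) f : tspan P f ->
  exists c g, tspan (fun l => P l /\ l <> 0%nat) g /\ forall t, f t = c + g t.
Proof.
  induction 1 as [|l d H|l d H|f1 f2 _ (c & g & Hg & E) _ (c' & g' & Hg' & E')|f1 f2 Ef _ (c & g & Hg & E)].
  - exists 0, (fun _ => 0). split; [apply tspan_zero|intros; ring].
  - destruct l as [|l].
    + exists d, (fun _ => 0). split; [apply tspan_zero|].
      intros t. simpl. rewrite Rmult_0_l, cos_0. ring.
    + exists 0, (fun t => d * cos (INR (S l) * t)). split; [apply tspan_cos; auto|intros; ring].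
  - destruct l as [|l].
    + exists 0, (fun _ => 0). split; [apply tspan_zero|].
      intros t. simpl. rewrite Rmult_0_l, sin_0. ring.
    + exists 0, (fun t => d * sin (INR (S l) * t)). split; [apply tspan_sin; auto|intros; ring].
  - exists (c + c'), (fun t => g t + g' t). split; [apply tspan_plus; auto|].
    intros t. rewrite E, E'. ring.
  - exists c, g. split; [exact Hg|]. intros t. now rewrite <- Ef.
Qed.

Lemma tspan_Cstrip k r P f : tspan P f -> Cstrip k r (fun t _ => f t).
Proof.
  induction 1 as [|l d H|l d H|f g _ IHf _ IHg|f g E _ IH].
  - apply Cstrip_const.
  - apply Cstrip_mult; [apply Cstrip_const|]. apply Cstrip_cos, Cstrip_mult; [apply Cstrip_const|apply Cstrip_t].
  - apply Cstrip_mult; [apply Cstrip_const|]. apply Cstrip_sin, Cstrip_mult; [apply Cstrip_const|apply Cstrip_t].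
  - apply Cstrip_plus; assumption.
  - eapply Cstrip_ext; [|exact IH]. intros; simpl; apply E.
Qed.

(** * Families with a graded expansion *)

(* [ring] does not see through the carrier of the structure in which Coquelicot's sums live. *)
Ltac real_ring := change plus with Rplus; match goal with |- @eq _ ?x ?y => change (@eq R x y) end; ring.

(** These closure properties make the graded families an algebra: orders add, and harmonics a and b
    produce a + b and |a - b|. *)
Definition grading (P : nat -> nat -> Prop) : Prop :=
  P 0%nat 0%nat /\
  (forall i j a b, P i a -> P j b -> P (i + j)%nat (a + b)%nat) /\
  (forall i j a b, P i a -> P j b -> P (i + j)%nat (a - b + (b - a))%nat).

(* Up to O(eps^(N+1)), the coefficient of eps^k has its harmonics in P k. *)
Inductive graded (P : nat -> nat -> Prop) (N : nat) : (R -> R -> R) -> Prop :=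
| graded_mono k a : tspan (P k) a -> graded P N (fun t e => e ^ k * a t)
| graded_plus F G : graded P N F -> graded P N G -> graded P N (fun t e => F t e + G t e)
| graded_near F G : O_eps (S N) (fun t e => F t e - G t e) -> graded P N G -> graded P N F.

Lemma graded_ext P N F G : (forall t e, F t e = G t e) -> graded P N G -> graded P N F.
Proof.
  intros E. apply graded_near. eapply O_eps_ext; [|apply O_eps_zero].
  intros t e; simpl; rewrite E; ring.
Qed.

Lemma graded_tspan P N f : tspan (P 0%nat) f -> graded P N (fun t _ => f t).
Proof.
  intros H. apply graded_ext with (fun t e => e ^ 0 * f t); [intros; simpl; ring|].
  apply graded_mono, H.
Qed.

Lemma graded_const P N c : grading P -> graded P N (fun _ _ => c).
Proof. intros [H _]. apply (graded_tspan P N (fun _ => c)), tspan_const, H. Qed.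

Lemma graded_scal P N c F : graded P N F -> graded P N (fun t e => c * F t e).
Proof.
  induction 1 as [k a H|F G _ IHF _ IHG|F G E _ IH].
  - apply graded_ext with (fun t e => e ^ k * (c * a t)); [intros; ring|].
    apply (graded_mono P N k (fun t => c * a t)), tspan_scal, H.
  - eapply graded_ext; [|exact (graded_plus _ _ _ _ IHF IHG)]. intros; simpl; ring.
  - eapply graded_near; [|exact IH].
    eapply O_eps_ext; [|exact (O_eps_scal _ c _ E)]. intros; simpl; ring.
Qed.

Lemma graded_minus P N F G : graded P N F -> graded P N G ->
  graded P N (fun t e => F t e - G t e).
Proof.
  intros HF HG. apply graded_ext with (fun t e => F t e + (-1) * G t e); [intros; ring|].
  apply graded_plus, graded_scal; assumption.
Qed.

Lemma graded_shift P N s F : graded P N F -> graded P N (fun t e => F (t + s) e).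
Proof.
  induction 1 as [k a H|F G _ IHF _ IHG|F G E _ IH].
  - apply (graded_mono P N k (fun t => a (t + s))), tspan_shift, H.
  - exact (graded_plus _ _ _ _ IHF IHG).
  - eapply graded_near; [|exact IH]. apply (O_eps_comp _ _ (fun t _ => t + s) E).
Qed.

Lemma graded_O_0 P N F : graded P N F -> O_eps 0 F.
Proof.
  induction 1 as [k a H|F G _ IHF _ IHG|F G E _ IH].
  - apply (O_eps_le k); [lia|]. apply O_eps_pow_bounded, (tspan_bounded _ _ H).
  - apply O_eps_plus; assumption.
  - apply (O_eps_near _ _ G); [exact IH|]. apply (O_eps_le (S N)); [lia|exact E].
Qed.

(** An error term multiplied by the other factor remains an error term because graded families are
    bounded near eps = 0 ([graded_O_0]). *)
Lemma graded_mult P N F G : grading P -> graded P N F -> graded P N G ->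
  graded P N (fun t e => F t e * G t e).
Proof.
  intros (_ & Hp & Hm) HF HG. pose proof (graded_O_0 _ _ _ HG) as HG0.
  induction HF as [k a Ha|F F' HF IHF HF' IHF'|F F' E HF IH].
  - clear HG0. induction HG as [l b Hb|G G' HG IHG HG' IHG'|G G' E HG IH].
    + apply graded_ext with (fun t e => e ^ (k + l) * (a t * b t)).
      { intros. rewrite pow_add. ring. }
      apply (graded_mono P N (k + l) (fun t => a t * b t)).
      apply (tspan_mult (P k) (P l)); auto.
    + eapply graded_ext; [|exact (graded_plus _ _ _ _ IHG IHG')]. intros; simpl; ring.
    + eapply graded_near; [|exact IH].
      apply (O_eps_ext _ _ (fun t e => (e ^ k * a t) * (G t e - G' t e))); [intros; ring|].
      apply (O_eps_mult 0 (S N)); [|exact E].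
      apply (graded_O_0 P N), graded_mono, Ha.
  - eapply graded_ext; [|exact (graded_plus _ _ _ _ IHF IHF')]. intros; simpl; ring.
  - eapply graded_near; [|exact IH].
    apply (O_eps_ext _ _ (fun t e => G t e * (F t e - F' t e))); [intros; ring|].
    apply (O_eps_mult 0 (S N)); assumption.
Qed.

Lemma graded_pow P N F k : grading P -> graded P N F -> graded P N (fun t e => F t e ^ k).
Proof.
  intros HP HF. induction k as [|k IH]; simpl; [apply graded_const, HP|].
  apply graded_mult; assumption.
Qed.

Lemma graded_expansion P N F : graded P N F ->
  exists a : nat -> R -> R, (forall i, tspan (P i) (a i)) /\
    O_eps (S N) (fun t e => F t e - sum_n (fun i => e ^ i * a i t) N).
Proof.
  induction 1 as [k a H|F G _ [a [Ha Ea]] _ [b [Hb Eb]]|F G E _ [a [Ha Ea]]].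
  (* A monomial of order k > N contributes to no coefficient kept and goes into the error. *)
  - exists (fun i => if Nat.eq_dec k i then a else fun _ => 0). split.
    { intros i. destruct (Nat.eq_dec k i) as [<-|]; [exact H|apply tspan_zero]. }
    assert (Hlt : forall M, (M < k)%nat -> forall t e,
      sum_n (fun i => e ^ i * (if Nat.eq_dec k i then a else fun _ => 0) t) M = 0).
    { intros M HM t e. unfold sum_n. rewrite (sum_n_m_ext_loc _ (fun _ => 0)).
      - rewrite sum_n_m_const. apply Rmult_0_r.
      - intros i Hi. destruct (Nat.eq_dec k i); [lia|apply Rmult_0_r]. }
    destruct (Nat.le_gt_cases k N) as [HN|HN].
    + apply (O_eps_ext _ _ (fun _ _ => 0)); [|apply O_eps_zero]. intros t e.
      match goal with |- ?A - ?B = 0 => replace B with A; [ring|] end.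
      clear - HN Hlt. induction N as [|N IH].
      * assert (k = 0%nat) as -> by lia. rewrite sum_O. simpl. real_ring.
      * rewrite sum_Sn. destruct (Nat.eq_dec k (S N)) as [->|Hne].
        -- rewrite Hlt by lia. real_ring.
        -- rewrite <- IH by lia. real_ring.
    + apply (O_eps_ext _ _ (fun t e => e ^ k * a t)).
      { intros t e. rewrite Hlt by exact HN. ring. }
      apply (O_eps_le k); [lia|]. apply O_eps_pow_bounded, (tspan_bounded _ _ H).
  - exists (fun i t => a i t + b i t). split; [intros i; apply tspan_plus; auto|].
    eapply O_eps_ext; [|exact (O_eps_plus _ _ _ Ea Eb)]. intros t e; simpl.
    rewrite (sum_n_ext _ (fun i => plus (e ^ i * a i t) (e ^ i * b i t))).
    + rewrite sum_n_plus. real_ring.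
    + intros i. change plus with Rplus. apply Rmult_plus_distr_l.
  - exists a. split; [exact Ha|]. exact (O_eps_trans _ _ _ _ E Ea).
Qed.

(** By uniqueness of the expansion the coefficients below N vanish, so what is left at order N is a
    single function with harmonics in [P N]. This is the term that the next correction has to
    remove. *)
Lemma graded_leading P N F : graded P N F -> O_eps N F ->
  exists a, tspan (P N) a /\ O_eps (S N) (fun t e => F t e - e ^ N * a t).
Proof.
  intros H HN. destruct (graded_expansion P N F H) as [a [Ha Ea]].
  exists (a N). split; [apply Ha|].
  assert (Z : forall i, (i < N)%nat -> forall t, a i t = 0).
  { apply O_eps_coefficients.
    apply (O_eps_ext _ _ (fun t e => F t e -
      (F t e - sum_n (fun i => e ^ i * a i t) N))).
    { assert (Hxy : forall x y : R, y = x - (x - y)) by (intros; ring). intros; apply Hxy. }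
    apply O_eps_minus; [exact HN|]. apply (O_eps_le (S N)); [lia|exact Ea]. }
  eapply O_eps_ext; [|exact Ea]. intros t e; simpl. f_equal. f_equal.
  destruct N as [|N]; [now rewrite sum_O|].
  rewrite sum_Sn. unfold sum_n. rewrite (sum_n_m_ext_loc _ (fun _ => 0)).
  - rewrite sum_n_m_const. real_ring.
  - intros i Hi. rewrite Z by lia. apply Rmult_0_r.
Qed.

(** * Taylor polynomials of sine and cosine, and composition of graded families *)

Inductive polynomial : (R -> R) -> Prop :=
| polynomial_zero : polynomial (fun _ => 0)
| polynomial_plus p c k : polynomial p -> polynomial (fun x => p x + c * x ^ k).

Lemma polynomial_antiderivative p y0 : polynomial p ->
  exists q, polynomial q /\ q 0 = y0 /\ forall x, is_derive q x (p x).
Proof.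
  induction 1 as [|p c k _ (q & Hq & H0 & D)].
  - exists (fun x => 0 + y0 * x ^ 0). split; [|split].
    + apply (polynomial_plus _ y0 0 polynomial_zero).
    + simpl; ring.
    + intros x. auto_derive; [auto|simpl; ring].
  - exists (fun x => q x + c / INR (S k) * x ^ S k). split; [|split].
    + apply (polynomial_plus q (c / INR (S k)) (S k) Hq).
    + rewrite H0. simpl. ring.
    + intros x. apply (is_derive_plus q (fun x => c / INR (S k) * x ^ S k)); [apply D|].
      auto_derive; [auto|]. simpl pred. pose proof (lt_0_INR (S k) (Nat.lt_0_succ k)).
      field. simpl in H. lra.
Qed.

(** The mean value theorem gives f(x) - q(x) = x (f' - p)(c) with |c| <= |x|, which gains one order.
    Only the order of contact matters, so no sharp constant is kept. *)
Lemma polynomial_approximation N (f f' p : R -> R) :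
  polynomial p -> (forall x, is_derive f x (f' x)) ->
  (forall x, Rabs (f' x - p x) <= Rabs x ^ N) ->
  exists q, polynomial q /\ forall x, Rabs (f x - q x) <= Rabs x ^ S N.
Proof.
  intros Hp D HN. destruct (polynomial_antiderivative p (f 0) Hp) as (q & Hq & H0 & Dq).
  exists q. split; [exact Hq|]. intros x.
  assert (Dm : forall y, is_derive (fun y => f y - q y) y (f' y - p y))
    by (intros; apply (is_derive_minus f q); auto).
  destruct (MVT_gen (fun y => f y - q y) 0 x (fun y => f' y - p y)) as [c [Hc E]].
  - intros; apply Dm.
  - intros y _. apply derivable_continuous_pt. exists (f' y - p y). apply is_derive_Reals, Dm.
  - rewrite H0, Rminus_diag, !Rminus_0_r in E. rewrite E, Rabs_mult. simpl pow at 1.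
    rewrite Rmult_comm. apply Rmult_le_compat_l; [apply Rabs_pos|].
    eapply Rle_trans; [apply HN|]. apply pow_incr. split; [apply Rabs_pos|].
    unfold Rmin, Rmax in Hc. destruct (Rle_dec 0 x); unfold Rabs; repeat destruct Rcase_abs; lra.
Qed.

(** The two statements are proved together since each function is, up to sign, the derivative of the
    other. *)
Lemma sin_cos_approximation N :
  (exists p, polynomial p /\ forall x, Rabs (sin x - p x) <= Rabs x ^ N) /\
  (exists p, polynomial p /\ forall x, Rabs (cos x - p x) <= Rabs x ^ N).
Proof.
  induction N as [|N [(p & Hp & Ep) (r & Hr & Er)]].
  - split; exists (fun _ => 0); (split; [apply polynomial_zero|]); intros x; simpl;
      rewrite Rminus_0_r; apply Rabs_le; [apply SIN_bound|apply COS_bound].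
  - split.
    + apply (polynomial_approximation N sin cos r Hr); [apply is_derive_sin|exact Er].
    + apply (polynomial_approximation N cos (fun x => - sin x) (fun x => - p x)).
      * clear - Hp. induction Hp as [|p c k _ IH].
        -- replace (fun _ => - 0) with (fun _ : R => 0); [apply polynomial_zero|].
           apply functional_extensionality; intros; ring.
        -- replace (fun x => - (p x + c * x ^ k)) with (fun x => - p x + (- c) * x ^ k);
             [exact (polynomial_plus _ _ _ IH)|].
           apply functional_extensionality; intros; ring.
      * apply is_derive_cos.
      * intros x. replace (- sin x - - p x) with (- (sin x - p x)) by ring.
        rewrite Rabs_Ropp. apply Ep.
Qed.

Lemma O_eps_power k F : O_eps 1 F -> O_eps k (fun t e => F t e ^ k).
Proof.
  intros H. induction k as [|k IH]; simpl.
  - apply (O_eps_bounded _ 1). intros. rewrite Rabs_R1. lra.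
  - apply (O_eps_mult 1 k); assumption.
Qed.

(** As F = O(eps), the Taylor remainder |F|^(N+1) is below the precision of the expansion, and only
    powers of F remain. *)
Lemma graded_sin_cos P N F : grading P -> graded P N F -> O_eps 1 F ->
  graded P N (fun t e => sin (F t e)) /\ graded P N (fun t e => cos (F t e)).
Proof.
  intros HP HF H1.
  assert (Hpoly : forall p, polynomial p -> graded P N (fun t e => p (F t e))).
  { induction 1 as [|p c k _ IH]; [apply graded_const, HP|].
    apply graded_plus; [exact IH|]. apply graded_scal, graded_pow; assumption. }
  destruct (sin_cos_approximation (S N)) as [(p & Hp & Ep) (r & Hr & Er)].
  split; [eapply graded_near; [|exact (Hpoly p Hp)]|eapply graded_near; [|exact (Hpoly r Hr)]];
    (eapply O_eps_dom; [|apply (O_eps_power (S N) F H1)]);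
    apply filter_forall; intros e t; rewrite Rmult_1_l, <- RPow_abs; auto.
Qed.

Lemma graded_sin_plus P N c F : grading P -> graded P N F -> O_eps 1 F ->
  graded P N (fun t e => sin (c + F t e)).
Proof.
  intros HP HF H1. destruct (graded_sin_cos P N F HP HF H1) as [Hs Hc].
  apply graded_ext with (fun t e => sin c * cos (F t e) + cos c * sin (F t e)).
  - intros; apply sin_plus.
  - apply graded_plus; apply graded_scal; assumption.
Qed.

Lemma graded_cos_plus P N c F : grading P -> graded P N F -> O_eps 1 F ->
  graded P N (fun t e => cos (c + F t e)).
Proof.
  intros HP HF H1. destruct (graded_sin_cos P N F HP HF H1) as [Hs Hc].
  apply graded_ext with (fun t e => cos c * cos (F t e) - sin c * sin (F t e)).
  - intros; apply cos_plus.
  - apply graded_minus; apply graded_scal; assumption.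
Qed.

Lemma graded_comp P N k g X : grading P -> tspan (P k) g -> graded P N X -> O_eps 1 X ->
  graded P N (fun t e => e ^ k * g (t + X t e)).
Proof.
  intros HP Hg HX H1. induction Hg as [|l d H|l d H|f g _ IHf _ IHg|f g E _ IH].
  - apply graded_ext with (fun _ _ => 0); [intros; ring|apply graded_const, HP].
  - destruct (graded_sin_cos P N (fun t e => INR l * X t e) HP) as [Hs Hc];
      [apply graded_scal, HX|apply O_eps_scal, H1|].
    apply graded_ext with (fun t e => (e ^ k * (d * cos (INR l * t))) * cos (INR l * X t e)
      - (e ^ k * (d * sin (INR l * t))) * sin (INR l * X t e)).
    + intros t e. rewrite Rmult_plus_distr_l, cos_plus. ring.
    + apply graded_minus; apply graded_mult; auto.
      * apply (graded_mono P N k (fun t => d * cos (INR l * t))), tspan_cos, H.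
      * apply (graded_mono P N k (fun t => d * sin (INR l * t))), tspan_sin, H.
  - destruct (graded_sin_cos P N (fun t e => INR l * X t e) HP) as [Hs Hc];
      [apply graded_scal, HX|apply O_eps_scal, H1|].
    apply graded_ext with (fun t e => (e ^ k * (d * sin (INR l * t))) * cos (INR l * X t e)
      + (e ^ k * (d * cos (INR l * t))) * sin (INR l * X t e)).
    + intros t e. rewrite Rmult_plus_distr_l, sin_plus. ring.
    + apply graded_plus; apply graded_mult; auto.
      * apply (graded_mono P N k (fun t => d * sin (INR l * t))), tspan_sin, H.
      * apply (graded_mono P N k (fun t => d * cos (INR l * t))), tspan_cos, H.
  - eapply graded_ext; [|exact (graded_plus _ _ _ _ IHf IHg)]. intros; simpl; ring.
  - eapply graded_ext; [|exact IH]. intros; simpl. now rewrite E.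
Qed.

Lemma graded_sum P N (F : nat -> R -> R -> R) i j : grading P ->
  (forall k, (i <= k <= j)%nat -> graded P N (F k)) ->
  graded P N (fun t e => sum_n_m (fun k => F k t e) i j).
Proof.
  intros HP. induction j as [|j IH]; intros H.
  - destruct i as [|i].
    + apply graded_ext with (F 0%nat); [intros t e; apply (sum_n_n (fun k => F k t e))|apply H; lia].
    + apply graded_ext with (fun _ _ => 0); [intros t e; apply (sum_n_m_zero (fun k => F k t e)); lia|apply graded_const, HP].
  - destruct (Nat.le_gt_cases i (S j)) as [Hij|Hij].
    + apply graded_ext with (fun t e => sum_n_m (fun k => F k t e) i j + F (S j) t e).
      * intros; now rewrite sum_n_Sm by exact Hij.
      * apply graded_plus; [apply IH; intros; apply H; lia|apply H; lia].
    + apply graded_ext with (fun _ _ => 0); [intros t e; apply (sum_n_m_zero (fun k => F k t e)); lia|apply graded_const, HP].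
Qed.

(** * Expansion of the support function and of its derivative *)

Lemma periodic_IZR f z t : periodic f -> f (t + 2 * PI * IZR z) = f t.
Proof.
  intros Hf.
  assert (Hn : forall n t, f (t + 2 * PI * INR n) = f t).
  { induction n as [|n IH]; intros s.
    - simpl. f_equal. ring.
    - rewrite S_INR. replace (s + 2 * PI * (INR n + 1)) with (s + 2 * PI * INR n + 2 * PI) by ring.
      rewrite Hf. apply IH. }
  destruct (Z.le_ge_cases 0 z) as [Hz|Hz].
  - rewrite <- (Z2Nat.id z) by exact Hz. rewrite <- INR_IZR_INZ. apply Hn.
  - rewrite <- (Hn (Z.to_nat (- z)) (t + 2 * PI * IZR z)). f_equal.
    rewrite INR_IZR_INZ, Z2Nat.id, opp_IZR by lia. ring.
Qed.

Lemma is_derive_shift (f : R -> R) s t l : is_derive f (t + s) l -> is_derive (fun t => f (t + s)) t l.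
Proof.
  intros D. evar_last; [apply (is_derive_comp f (fun t => t + s))|].
  - exact D.
  - apply (is_derive_plus (fun t => t) (fun _ => s)); [apply @is_derive_id|apply @is_derive_const].
  - change ((1 + 0) * l = l). ring.
Qed.

Lemma periodic_is_derive (f f' : R -> R) : periodic f ->
  (forall t, is_derive f t (f' t)) -> periodic f'.
Proof.
  intros Hp D t. rewrite <- (is_derive_unique _ _ _ (D t)).
  rewrite <- (Derive_ext (fun s => f (s + 2 * PI)) f t Hp).
  symmetry. apply is_derive_unique, is_derive_shift, D.
Qed.

Lemma mod_2PI t : exists z : Z, 0 <= t + 2 * PI * IZR z <= 2 * PI.
Proof.
  pose proof PI_RGT_0 as Hpi. exists (- Int_part (t / (2 * PI)))%Z.
  rewrite opp_IZR. destruct (base_Int_part (t / (2 * PI))) as [H1 H2].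
  replace t with (2 * PI * (t / (2 * PI))) at 1 3 by (field; lra). split; nra.
Qed.

(** Compactness of one period: the slice at eps = 0 is bounded, and uniform continuity carries the
    bound to nearby eps. *)
Lemma periodic_O_eps_0 r f : 0 < r -> Cstrip 0 r f ->
  (forall e, Rabs e < r -> periodic (slice f e)) -> O_eps 0 f.
Proof.
  intros Hr [Hc _] Hp.
  assert (H0 : Rabs 0 < r) by (rewrite Rabs_R0; exact Hr).
  destruct (bounded_continuity (slice f 0) 0 (2 * PI)) as [M HM].
  { intros x _. apply (continuous_comp_2 (fun x => x) (fun _ => 0) f).
    - apply continuous_id. - apply continuous_const. - apply Hc, H0. }
  destruct (uniform_continuity_2d_1d f 0 (2 * PI) 0) with (eps := mkposreal 1 Rlt_0_1) as [d Hd].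
  { intros x _. apply continuity_2d_pt_filterlim. apply Hc, H0. }
  exists (M + 1).
  generalize (filter_and _ _ (locally_0_Rabs_lt r Hr) (locally_0_Rabs_lt d (cond_pos d))).
  apply filter_imp. intros e [He Hde] t. simpl. rewrite Rmult_1_r.
  destruct (mod_2PI t) as [z Hz].
  change (f t e) with (slice f e t). rewrite <- (periodic_IZR (slice f e) z t (Hp e He)).
  set (s := t + 2 * PI * IZR z) in *.
  specialize (HM s Hz). change norm with Rabs in HM. unfold slice in *.
  assert (Rabs (f s e - f s 0) < 1).
  { apply (Hd s 0 s e); auto; apply Rabs_def2 in Hde; try (rewrite Rminus_diag, Rabs_R0); try lra. }
  replace (f s e) with (f s 0 + (f s e - f s 0)) by ring.
  eapply Rle_trans; [apply Rabs_triang|]. lra.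
Qed.

(** On [t, t + d] some value of f' has modulus at most 2 A / d, and f' varies by at most B d on that
    interval. *)
Lemma landau_inequality (f f' f'' : R -> R) A B d :
  (forall t, is_derive f t (f' t)) -> (forall t, is_derive f' t (f'' t)) ->
  (forall t, Rabs (f t) <= A) -> (forall t, Rabs (f'' t) <= B) -> 0 < d ->
  forall t, Rabs (f' t) * d <= 2 * A + B * (d * d).
Proof.
  intros D1 D2 HA HB Hd t.
  destruct (MVT_gen f t (t + d) f') as [c [Hc E]].
  - intros; apply D1.
  - intros x _. apply derivable_continuous_pt. exists (f' x). apply is_derive_Reals, D1.
  - rewrite Rmin_left, Rmax_right in Hc by lra.
    pose proof (bounded_derive_lipschitz f' f'' B D2 HB c t) as L.
    assert (HBd : B * Rabs (t - c) <= B * d).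
    { apply Rmult_le_compat_l.
      - specialize (HB t). pose proof (Rabs_pos (f'' t)). lra.
      - apply Rabs_le. lra. }
    replace (f' t) with (f' c + (f' t - f' c)) by ring.
    assert (Rabs (f' c) * d <= 2 * A).
    { rewrite <- (Rabs_pos_eq d) at 1 by lra. rewrite <- Rabs_mult.
      replace (f' c * d) with (f (t + d) - f t) by (rewrite E; ring).
      eapply Rle_trans; [apply Rabs_triang|]. rewrite Rabs_Ropp.
      pose proof (HA t); pose proof (HA (t + d)). lra. }
    pose proof (Rabs_triang (f' c) (f' t - f' c)). nra.
Qed.

(** Landau's inequality with d = |e|^(N+1) balances the two terms: F of order 2 (N+1) and a bounded
    second derivative give order N+1 for the first. *)
Lemma O_eps_derivative N (F F' F'' : R -> R -> R) :
  locally 0 (fun e => forall t, is_derive (slice F e) t (F' t e)) ->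
  locally 0 (fun e => forall t, is_derive (slice F' e) t (F'' t e)) ->
  O_eps (2 * S N) F -> O_eps 0 F'' -> O_eps (S N) F'.
Proof.
  intros D1 D2 [A HA] [B HB]. exists (2 * A + B).
  generalize (filter_and _ _ (filter_and _ _ D1 D2) (filter_and _ _ HA HB)).
  apply filter_imp. clear. intros e [[D1 D2] [HA HB]] t.
  destruct (Req_dec e 0) as [->|He].
  (* Here d would be 0, but the bound forces F to vanish identically at e = 0, and hence its
     derivative too. *)
  - assert (Z : forall t, F t 0 = 0).
    { intros s. specialize (HA s). rewrite Rabs_R0, pow_i, Rmult_0_r in HA by lia.
      pose proof (Rabs_pos (F s 0)). destruct (Req_dec (F s 0) 0) as [|Hne]; [assumption|].
      apply Rabs_pos_lt in Hne. lra. }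
    assert (E : F' t 0 = 0).
    { rewrite <- (is_derive_unique _ _ _ (D1 t)).
      rewrite (Derive_ext _ (fun _ => 0)); [apply Derive_const|exact Z]. }
    rewrite E, Rabs_R0, pow_i, Rmult_0_r by lia. lra.
  - pose proof (pow_lt _ (S N) (Rabs_pos_lt e He)) as Hd.
    apply Rmult_le_reg_r with (Rabs e ^ S N); [exact Hd|].
    eapply Rle_trans; [apply (landau_inequality (slice F e) (slice F' e) (slice F'' e)
      (A * Rabs e ^ (2 * S N)) B); auto|].
    + intros s. specialize (HB s). simpl in HB. unfold slice. lra.
    + right. replace (2 * S N)%nat with (S N + S N)%nat by lia. rewrite pow_add. ring.
Qed.

Lemma tspan_Derive P f : tspan P f ->
  tspan P (Derive f) /\ forall t, is_derive f t (Derive f t).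
Proof.
  intros H. destruct (tspan_derive P f H) as [g [Hg D]]. split.
  - apply tspan_ext with g; [|exact Hg]. intros t. symmetry. apply is_derive_unique, D.
  - intros t. apply Derive_correct. exists (g t). apply D.
Qed.

Lemma is_derive_sum (a : nat -> R -> R) (b : nat -> R) i j t :
  (forall k, (i <= k <= j)%nat -> is_derive (a k) t (b k)) ->
  is_derive (fun t => sum_n_m (fun k => a k t) i j) t (sum_n_m b i j).
Proof.
  induction j as [|j IH]; intros H.
  - destruct i as [|i].
    + rewrite sum_n_n. eapply is_derive_ext; [|apply (H 0%nat); lia].
      intros s. symmetry. apply (sum_n_n (fun k => a k s)).
    + rewrite sum_n_m_zero by lia. eapply is_derive_ext; [|apply @is_derive_const].
      intros s. symmetry. apply (sum_n_m_zero (fun k => a k s)). lia.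
  - destruct (Nat.le_gt_cases i (S j)) as [Hij|Hij].
    + rewrite sum_n_Sm by exact Hij.
      apply is_derive_ext with (fun t => plus (sum_n_m (fun k => a k t) i j) (a (S j) t)).
      * intros s. symmetry. apply (sum_n_Sm (fun k => a k s)), Hij.
      * apply (is_derive_plus (fun t => sum_n_m (fun k => a k t) i j) (a (S j))).
        -- apply IH. intros; apply H; lia.
        -- apply H; lia.
    + rewrite sum_n_m_zero by lia. eapply is_derive_ext; [|apply @is_derive_const].
      intros s. symmetry. apply (sum_n_m_zero (fun k => a k s)). lia.
Qed.

Lemma O_eps_sum m (F : nat -> R -> R -> R) i j :
  (forall k, (i <= k <= j)%nat -> O_eps m (F k)) ->
  O_eps m (fun t e => sum_n_m (fun k => F k t e) i j).
Proof.
  induction j as [|j IH]; intros H.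
  - destruct i as [|i].
    + apply (O_eps_ext _ _ (F 0%nat)); [intros t e; apply (sum_n_n (fun k => F k t e))|apply H; lia].
    + apply (O_eps_ext _ _ (fun _ _ => 0));
        [intros t e; apply (sum_n_m_zero (fun k => F k t e)); lia|apply O_eps_zero].
  - destruct (Nat.le_gt_cases i (S j)) as [Hij|Hij].
    + apply (O_eps_ext _ _ (fun t e => sum_n_m (fun k => F k t e) i j + F (S j) t e)).
      * intros t e; now apply (sum_n_Sm (fun k => F k t e)).
      * apply O_eps_plus; [apply IH; intros; apply H; lia|apply H; lia].
    + apply (O_eps_ext _ _ (fun _ _ => 0));
        [intros t e; apply (sum_n_m_zero (fun k => F k t e)); lia|apply O_eps_zero].
Qed.

Lemma derivative_expansion e0 h hk P :
  deformation e0 h hk -> (forall k, (1 <= k)%nat -> tspan (P k) (hk k)) ->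
  forall N, O_eps (S N) (fun s e => Derive (slice h e) s
    - sum_n_m (fun k => e ^ k * Derive (hk k) s) 1 N).
Proof.
  intros (He0 & Hs & Hconv & Hexp) HP N.
  (* M + 1 = 2 (N + 1) is the order that [O_eps_derivative] consumes. The terms between N + 1 and M
     are dropped at the end, being themselves O(eps^(N+1)). *)
  set (M := (2 * N + 1)%nat).
  assert (HM : O_eps (S N) (fun s e => Derive (slice h e) s
    - sum_n_m (fun k => e ^ k * Derive (hk k) s) 1 M)).
  { pose proof (Ck_Cstrip 2 _ _ (Hs 2%nat)) as H2.
    destruct H2 as [_ (h1 & _ & D1 & _ & [_ (h2 & _ & D2 & _ & H2 & _)] & _)].
    assert (E : forall e s, Rabs e < e0 -> Derive (slice h e) s = h1 s e)
      by (intros; apply is_derive_unique, D1; auto).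
    apply (O_eps_ext_loc _ _ (fun s e => h1 s e - sum_n_m (fun k => e ^ k * Derive (hk k) s) 1 M)).
    { generalize (locally_0_Rabs_lt e0 He0); apply filter_imp. intros e He t. now rewrite E. }
    apply (O_eps_derivative N
      (fun s e => h s e - (1 + sum_n_m (fun k => e ^ k * hk k s) 1 M)) _
      (fun s e => h2 s e - sum_n_m (fun k => e ^ k * Derive (Derive (hk k)) s) 1 M)).
    - generalize (locally_0_Rabs_lt e0 He0); apply filter_imp. intros e He t.
      apply (is_derive_minus (slice h e) (fun s => 1 + sum_n_m (fun k => e ^ k * hk k s) 1 M)).
      + apply D1, He.
      + evar_last.
        * apply (is_derive_plus (fun _ => 1) (fun s => sum_n_m (fun k => e ^ k * hk k s) 1 M)).
          -- apply @is_derive_const.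
          -- apply (is_derive_sum (fun k s => e ^ k * hk k s) (fun k => e ^ k * Derive (hk k) t)).
             intros k Hk. apply is_derive_scal.
             apply (tspan_Derive (P k)), HP; lia.
        * apply Rplus_0_l.
    - generalize (locally_0_Rabs_lt e0 He0); apply filter_imp. intros e He t.
      apply (is_derive_minus (slice h1 e) (fun s => sum_n_m (fun k => e ^ k * Derive (hk k) s) 1 M)).
      + apply D2, He.
      + apply (is_derive_sum (fun k s => e ^ k * Derive (hk k) s)
          (fun k => e ^ k * Derive (Derive (hk k)) t)).
        intros k Hk. apply is_derive_scal.
        apply (tspan_Derive (P k)), tspan_Derive, HP; lia.
    - replace (2 * S N)%nat with (S M) by (unfold M; lia). apply Hexp.
    - apply O_eps_minus.
      + apply (periodic_O_eps_0 e0); [exact He0|exact H2|].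
        intros e He. apply (periodic_is_derive (slice h1 e)); [|intros; apply D2, He].
        apply (periodic_is_derive (slice h e)); [apply Hconv; lra|intros; apply D1, He].
      + apply O_eps_sum. intros k Hk. apply (O_eps_le k); [lia|].
        apply O_eps_pow_bounded, (tspan_bounded (P k)), tspan_Derive, tspan_Derive, HP. lia. }
  eapply O_eps_ext; [|refine (O_eps_plus _ _ _ HM (O_eps_sum (S N)
    (fun k s e => e ^ k * Derive (hk k) s) (S N) M _))].
  - intros s e. simpl. rewrite (sum_n_m_Chasles _ 1 N M) by (unfold M; lia).
    change plus with Rplus.
    assert (Hxy : forall x y z : R, x - y = x - (y + z) + z) by (intros; ring). apply Hxy.
  - intros k Hk. apply (O_eps_le k); [lia|].
    apply O_eps_pow_bounded, (tspan_bounded (P k)), tspan_Derive, HP. lia.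
Qed.

(** * The defect of an approximate caustic *)

(* With [phi t e = t - w/2 + X t e], these are [psi], [theta] and the two values
   of [lambda] at the impact, before and after the reflection. *)
Definition impact (w : R) (X : R -> R -> R) (t e : R) : R := t + (X (t + w) e + X t e) / 2.
Definition incidence (w : R) (X : R -> R -> R) (t e : R) : R := w / 2 + (X (t + w) e - X t e) / 2.
Definition lambda_in (h : R -> R -> R) (w : R) (X : R -> R -> R) (t e : R) : R :=
  h (impact w X t e) e * cos (incidence w X t e)
  - Derive (slice h e) (impact w X t e) * sin (incidence w X t e).
Definition lambda_out (h : R -> R -> R) (w : R) (X : R -> R -> R) (t e : R) : R :=
  h (impact w X t e) e * cos (incidence w X t e)
  + Derive (slice h e) (impact w X t e) * sin (incidence w X t e).
(** Once rearranged, this is both the left-hand side of the equation in (F) and the second component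
    of the error in (P). *)
Definition defect (h : R -> R -> R) (w : R) (X : R -> R -> R) (t e : R) : R :=
  lambda_out h w X t e - lambda_in h w X (t + w) e.

(** The expansion of h' is part of the data because a uniform expansion of h does not by itself
    allow termwise differentiation. *)
Definition graded_support (P : nat -> nat -> Prop) (h : R -> R -> R) : Prop :=
  exists hk : nat -> R -> R,
    (forall k, (1 <= k)%nat -> tspan (P k) (hk k)) /\
    asymp_expansion h hk /\
    forall N, O_eps (S N) (fun s e => Derive (slice h e) s
      - sum_n_m (fun k => e ^ k * Derive (hk k) s) 1 N).

Lemma graded_defect P N h w X : grading P -> graded_support P h ->
  graded P N X -> O_eps 1 X -> graded P N (defect h w X).
Proof.
  intros HP (hk & Hhk & Hh & Hh') HX H1.
  assert (HXw : graded P N (fun t e => X (t + w) e)) by apply graded_shift, HX.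
  assert (H1w : O_eps 1 (fun t e => X (t + w) e)) by apply (O_eps_comp _ _ (fun t _ => t + w) H1).
  set (Y := fun t e => / 2 * (X (t + w) e + X t e)).
  set (Z := fun t e => / 2 * (X (t + w) e - X t e)).
  assert (HY : graded P N Y) by (apply graded_scal, graded_plus; assumption).
  assert (HZ : graded P N Z) by (apply graded_scal, graded_minus; assumption).
  assert (HY1 : O_eps 1 Y) by (apply O_eps_scal, O_eps_plus; assumption).
  assert (HZ1 : O_eps 1 Z) by (apply O_eps_scal, O_eps_minus; assumption).
  assert (EY : forall t e, impact w X t e = t + Y t e) by (intros; unfold impact, Y; field).
  assert (EZ : forall t e, incidence w X t e = w / 2 + Z t e) by (intros; unfold incidence, Z; field).
  assert (Gh : graded P N (fun t e => h (impact w X t e) e)).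
  { eapply graded_near; [apply (O_eps_comp _ _ (impact w X) (Hh N))|].
    apply graded_plus; [apply graded_const, HP|].
    apply (graded_sum P N (fun k t e => e ^ k * hk k (impact w X t e))); [exact HP|].
    intros k Hk. apply graded_ext with (fun t e => e ^ k * hk k (t + Y t e)).
    - intros; now rewrite EY.
    - apply graded_comp; auto. apply Hhk; lia. }
  assert (Gh' : graded P N (fun t e => Derive (slice h e) (impact w X t e))).
  { eapply graded_near; [apply (O_eps_comp _ _ (impact w X) (Hh' N))|].
    apply (graded_sum P N (fun k t e => e ^ k * Derive (hk k) (impact w X t e))); [exact HP|].
    intros k Hk. apply graded_ext with (fun t e => e ^ k * Derive (hk k) (t + Y t e)).
    - intros; now rewrite EY.
    - apply graded_comp; auto. apply tspan_Derive, Hhk; lia. }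
  assert (Gs : graded P N (fun t e => sin (incidence w X t e))).
  { apply graded_ext with (fun t e => sin (w / 2 + Z t e)).
    - intros; now rewrite EZ. - apply graded_sin_plus; auto. }
  assert (Gc : graded P N (fun t e => cos (incidence w X t e))).
  { apply graded_ext with (fun t e => cos (w / 2 + Z t e)).
    - intros; now rewrite EZ. - apply graded_cos_plus; auto. }
  apply graded_minus.
  - apply graded_plus; apply graded_mult; assumption.
  - apply (graded_shift P N w (lambda_in h w X)). apply graded_minus; apply graded_mult; assumption.
Qed.

(** One order is gained over the displacement: the constant c cancels, and every other term carries
    a factor e^i with i >= 1 in front of a Lipschitz function. *)
Lemma expansion_lipschitz P k c F g S1 S2 :
  O_eps (S k) (fun s e => F s e - (c + sum_n_m (fun i => e ^ i * g i s) 1 k)) ->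
  (forall i, (1 <= i)%nat -> tspan (P i) (g i)) ->
  O_eps k (fun t e => S2 t e - S1 t e) ->
  O_eps (S k) (fun t e => F (S2 t e) e - F (S1 t e) e).
Proof.
  intros HF Hg HS.
  pose proof (O_eps_comp _ _ S1 HF) as H1. pose proof (O_eps_comp _ _ S2 HF) as H2.
  assert (H3 : O_eps (S k) (fun t e => sum_n_m (fun i => e ^ i * (g i (S2 t e) - g i (S1 t e))) 1 k)).
  { apply (O_eps_sum (S k) (fun i t e => e ^ i * (g i (S2 t e) - g i (S1 t e)))).
    intros i Hi. apply (O_eps_le (i + k)); [lia|].
    apply (O_eps_pow_mult i k (fun t e => g i (S2 t e) - g i (S1 t e))).
    destruct (tspan_lipschitz (P i) (g i)) as [K HK]; [apply Hg; lia|].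
    eapply (O_eps_dom k K); [|exact HS]. apply filter_forall. intros; apply HK. }
  eapply O_eps_ext; [|exact (O_eps_plus _ _ _ (O_eps_minus _ _ _ H2 H1) H3)].
  intros t e. simpl.
  rewrite (sum_n_m_ext (fun i => e ^ i * (g i (S2 t e) - g i (S1 t e)))
    (fun i => plus (e ^ i * g i (S2 t e)) (mult (-1) (e ^ i * g i (S1 t e))))).
  - rewrite sum_n_m_plus, (sum_n_m_mult_l (K := R_Ring)). change plus with Rplus. change mult with Rmult.
    assert (Hxy : forall x y z u : R, x - y = x - (c + z) - (y - (c + u)) + (z + -1 * u))
      by (intros; ring). apply Hxy.
  - intros i. change mult with Rmult. real_ring.
Qed.

Lemma sin_lipschitz a b : Rabs (sin a - sin b) <= Rabs (a - b).
Proof.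
  rewrite <- (Rmult_1_l (Rabs (a - b))).
  apply (bounded_derive_lipschitz sin cos 1); [apply is_derive_sin|].
  intros; apply Rabs_le, COS_bound.
Qed.

Lemma cos_lipschitz a b : Rabs (cos a - cos b) <= Rabs (a - b).
Proof.
  rewrite <- (Rmult_1_l (Rabs (a - b))).
  apply (bounded_derive_lipschitz cos (fun x => - sin x) 1); [apply is_derive_cos|].
  intros; rewrite Rabs_Ropp. apply Rabs_le, SIN_bound.
Qed.

(** The slope is taken at c rather than at a, so that with c = w / 2 the linearized equation has a
    constant coefficient; the term |a - c| is the price. *)
Lemma cos_linearization a b c :
  Rabs (cos b - cos a + (b - a) * sin c) <= Rabs (b - a) * (Rabs (b - a) + Rabs (a - c)).
Proof.
  destruct (MVT_gen cos a b (fun x => - sin x)) as [x [Hx E]].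
  - intros; apply is_derive_cos.
  - intros y _. apply continuity_cos.
  - rewrite E. replace (- sin x * (b - a) + (b - a) * sin c) with ((b - a) * (sin c - sin x)) by ring.
    rewrite Rabs_mult. apply Rmult_le_compat_l; [apply Rabs_pos|].
    eapply Rle_trans; [apply sin_lipschitz|].
    replace (c - x) with ((a - x) - (a - c)) by ring.
    eapply Rle_trans; [apply Rabs_triang|]. rewrite Rabs_Ropp. apply Rplus_le_compat_r.
    unfold Rmin, Rmax in Hx. destruct (Rle_dec a b); unfold Rabs; repeat destruct Rcase_abs; lra.
Qed.

Lemma O_eps_sin F : O_eps 0 (fun t e => sin (F t e)).
Proof. apply (O_eps_bounded _ 1). intros; apply Rabs_le, SIN_bound. Qed.

Lemma O_eps_cos F : O_eps 0 (fun t e => cos (F t e)).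
Proof. apply (O_eps_bounded _ 1). intros; apply Rabs_le, COS_bound. Qed.

Lemma graded_support_1 P h : graded_support P h -> O_eps 1 (fun s e => h s e - 1).
Proof.
  intros (hk & _ & Hh & _). eapply O_eps_ext; [|exact (Hh 0%nat)].
  intros t e. simpl. rewrite sum_n_m_zero by lia. change zero with 0. ring.
Qed.

Lemma graded_support_derive P h : graded_support P h ->
  O_eps 1 (fun s e => Derive (slice h e) s).
Proof.
  intros (hk & _ & _ & Hh). eapply O_eps_ext; [|exact (Hh 0%nat)].
  intros t e. simpl. rewrite sum_n_m_zero by lia. symmetry. apply Rminus_0_r.
Qed.

(** Starting point of the induction: for the unit circle and X = 0, both values of lambda equal cos
    (w / 2). *)
Lemma defect_circle P h w : graded_support P h -> O_eps 1 (defect h w (fun _ _ => 0)).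
Proof.
  intros HG. pose proof (graded_support_1 P h HG) as H1. pose proof (graded_support_derive P h HG) as H2.
  assert (Hi : O_eps 1 (fun t e => lambda_in h w (fun _ _ => 0) t e - cos (w / 2))).
  { apply (O_eps_ext _ _ (fun t e =>
      (h (impact w (fun _ _ => 0) t e) e - 1) * cos (incidence w (fun _ _ => 0) t e)
      - Derive (slice h e) (impact w (fun _ _ => 0) t e) * sin (incidence w (fun _ _ => 0) t e))).
    - intros. unfold lambda_in, incidence. replace (w / 2 + (0 - 0) / 2) with (w / 2) by field. ring.
    - apply O_eps_minus; apply (O_eps_mult 1 0); auto using O_eps_sin, O_eps_cos.
      + apply (O_eps_comp _ _ (impact w (fun _ _ => 0)) H1).
      + apply (O_eps_comp _ _ (impact w (fun _ _ => 0)) H2). }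
  assert (Ho : O_eps 1 (fun t e => lambda_out h w (fun _ _ => 0) t e - cos (w / 2))).
  { apply (O_eps_ext _ _ (fun t e =>
      (h (impact w (fun _ _ => 0) t e) e - 1) * cos (incidence w (fun _ _ => 0) t e)
      + Derive (slice h e) (impact w (fun _ _ => 0) t e) * sin (incidence w (fun _ _ => 0) t e))).
    - intros. unfold lambda_out, incidence. replace (w / 2 + (0 - 0) / 2) with (w / 2) by field. ring.
    - apply O_eps_plus; apply (O_eps_mult 1 0); auto using O_eps_sin, O_eps_cos.
      + apply (O_eps_comp _ _ (impact w (fun _ _ => 0)) H1).
      + apply (O_eps_comp _ _ (impact w (fun _ _ => 0)) H2). }
  eapply O_eps_ext; [|exact (O_eps_minus _ _ _ Ho (O_eps_comp _ _ (fun t _ => t + w) Hi))].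
  intros t e. unfold defect. simpl. ring.
Qed.

(** At order k only the change of cos theta in h cos theta survives. Those of h, of h' and of sin
    theta in h' sin theta are O(eps^(k+1)). The change of theta is a first difference of y, and
    comparing t with t + w turns it into a second difference. *)
Lemma defect_perturbation P Q h w X k y :
  graded_support P h -> O_eps 1 X -> (1 <= k)%nat -> tspan Q y ->
  O_eps (S k) (fun t e => defect h w (fun t e => X t e + e ^ k * y t) t e
    - (defect h w X t e + e ^ k * (sin (w / 2) / 2 * (y (t + 2 * w) - 2 * y (t + w) + y t)))).
Proof.
  intros HG H1 Hk Hy.
  pose proof (graded_support_1 P h HG) as Hh1. pose proof (graded_support_derive P h HG) as Hh1'.
  destruct HG as (hk & Hhk & Hh & Hh').
  set (X' := fun t e => X t e + e ^ k * y t).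
  assert (Oy : forall f : R -> R, tspan Q f -> O_eps k (fun t e => e ^ k * f t))
    by (intros f Hf; apply O_eps_pow_bounded, (tspan_bounded Q f Hf)).
  assert (H1w : O_eps 1 (fun t e => X (t + w) e)) by apply (O_eps_comp _ _ (fun t _ => t + w) H1).
  assert (OY : O_eps k (fun t e => impact w X' t e - impact w X t e)).
  { apply (O_eps_ext _ _ (fun t e => / 2 * (e ^ k * y (t + w) + e ^ k * y t))).
    - intros; unfold impact, X'; field.
    - apply O_eps_scal, O_eps_plus; [|auto]. apply (Oy (fun t => y (t + w))), tspan_shift, Hy. }
  assert (OZ : O_eps k (fun t e => incidence w X' t e - incidence w X t e)).
  { apply (O_eps_ext _ _ (fun t e => / 2 * (e ^ k * y (t + w) - e ^ k * y t))).
    - intros; unfold incidence, X'; field.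
    - apply O_eps_scal, O_eps_minus; [|auto]. apply (Oy (fun t => y (t + w))), tspan_shift, Hy. }
  assert (Oh : O_eps (S k) (fun t e => h (impact w X' t e) e - h (impact w X t e) e)).
  { apply (expansion_lipschitz P k 1 h hk); auto. }
  assert (Oh' : O_eps (S k) (fun t e => Derive (slice h e) (impact w X' t e)
    - Derive (slice h e) (impact w X t e))).
  { apply (expansion_lipschitz P k 0 (fun s e => Derive (slice h e) s) (fun i => Derive (hk i))); auto.
    - eapply O_eps_ext; [|exact (Hh' k)]. intros; simpl. rewrite Rplus_0_l. reflexivity.
    - intros i Hi. apply tspan_Derive, Hhk, Hi. }
  assert (Osin : O_eps k (fun t e => sin (incidence w X' t e) - sin (incidence w X t e))).
  { eapply (O_eps_dom k 1); [|exact OZ]. apply filter_forall. intros e t.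
    rewrite Rmult_1_l. apply sin_lipschitz. }
  assert (Ocos : O_eps k (fun t e => cos (incidence w X' t e) - cos (incidence w X t e))).
  { eapply (O_eps_dom k 1); [|exact OZ]. apply filter_forall. intros e t.
    rewrite Rmult_1_l. apply cos_lipschitz. }
  (* The error is the increment, of order k, times a factor of order 1; that factor contains the
     increment itself, which is where 1 <= k enters. *)
  assert (Olin : O_eps (S k) (fun t e => cos (incidence w X' t e) - cos (incidence w X t e)
    + (incidence w X' t e - incidence w X t e) * sin (w / 2))).
  { apply (O_eps_dom (S k) 1) with (fun t e =>
      (Rabs (incidence w X' t e - incidence w X t e) + Rabs (incidence w X t e - w / 2))
      * (incidence w X' t e - incidence w X t e)).
    - apply filter_forall. intros e t. rewrite Rmult_1_l, Rabs_mult.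
      rewrite (Rabs_pos_eq (Rabs _ + Rabs _)) by (apply Rplus_le_le_0_compat; apply Rabs_pos).
      rewrite (Rmult_comm (Rabs _ + Rabs _)).
      apply cos_linearization.
    - apply (O_eps_mult 1 k); [|exact OZ]. apply O_eps_plus.
      + apply (O_eps_le k); [exact Hk|]. eapply (O_eps_dom k 1); [|exact OZ].
        apply filter_forall. intros; rewrite Rabs_Rabsolu. lra.
      + apply (O_eps_dom 1 1) with (fun t e => / 2 * (X (t + w) e - X t e)).
        * apply filter_forall. intros. rewrite Rabs_Rabsolu, Rmult_1_l. unfold incidence.
          right. f_equal. field.
        * apply O_eps_scal, O_eps_minus; assumption. }
  assert (HY1 : forall F, O_eps 1 F -> O_eps 1 (fun t e => F (impact w X t e) e))
    by (intros F HF; apply (O_eps_comp _ _ (impact w X) HF)).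
  (* A is the change of h' sin theta; B below is the change of h cos theta freed from its linear
     part. Both are negligible. *)
  pose (A := fun t e => Derive (slice h e) (impact w X' t e) * sin (incidence w X' t e)
    - Derive (slice h e) (impact w X t e) * sin (incidence w X t e)).
  assert (HA : O_eps (S k) A).
  { apply (O_eps_ext _ _ (fun t e =>
      sin (incidence w X' t e) * (Derive (slice h e) (impact w X' t e) - Derive (slice h e) (impact w X t e))
      + Derive (slice h e) (impact w X t e) * (sin (incidence w X' t e) - sin (incidence w X t e)))).
    - intros; unfold A; ring.
    - apply O_eps_plus.
      + apply (O_eps_mult 0 (S k)); [apply O_eps_sin|exact Oh'].
      + apply (O_eps_mult 1 k); [apply (HY1 _ Hh1')|exact Osin]. }
  pose (B := fun t e => h (impact w X' t e) e * cos (incidence w X' t e)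
    - h (impact w X t e) e * cos (incidence w X t e)
    + (incidence w X' t e - incidence w X t e) * sin (w / 2)).
  assert (HB : O_eps (S k) B).
  { apply (O_eps_ext _ _ (fun t e =>
      (cos (incidence w X' t e) * (h (impact w X' t e) e - h (impact w X t e) e)
      + (h (impact w X t e) e - 1) * (cos (incidence w X' t e) - cos (incidence w X t e)))
      + (cos (incidence w X' t e) - cos (incidence w X t e)
         + (incidence w X' t e - incidence w X t e) * sin (w / 2)))).
    - intros; unfold B; ring.
    - apply O_eps_plus; [apply O_eps_plus|exact Olin].
      + apply (O_eps_mult 0 (S k)); [apply O_eps_cos|exact Oh].
      + apply (O_eps_mult 1 k); [apply (HY1 _ Hh1)|exact Ocos]. }
  eapply O_eps_ext; [|exact (O_eps_plus _ _ _
    (O_eps_plus _ _ _ HA (O_eps_comp _ _ (fun t _ => t + w) HA))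
    (O_eps_minus _ _ _ HB (O_eps_comp _ _ (fun t _ => t + w) HB)))].
  intros t e. unfold defect, lambda_in, lambda_out, A, B. fold X'.
  assert (EZ : forall t e, incidence w X' t e - incidence w X t e = e ^ k * (y (t + w) - y t) / 2)
    by (intros; unfold incidence, X'; field).
  rewrite !EZ. replace (t + w + w) with (t + 2 * w) by ring. field.
Qed.

(** * Order by order solution *)

(** Keeping resonant harmonics out of every y gives X zero mean over each orbit of the rotation,
    which is what the normalizations by [mu] in (F) require. *)
Inductive correction (P : nat -> nat -> Prop) (w : R) : (R -> R -> R) -> Prop :=
| correction_zero : correction P w (fun _ _ => 0)
| correction_plus X k y :
    correction P w X -> (1 <= k)%nat ->
    tspan (fun l => P k l /\ cos (INR l * w) <> 1) y ->
    correction P w (fun t e => X t e + e ^ k * y t).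

Lemma correction_graded P w N X : grading P -> correction P w X -> graded P N X.
Proof.
  intros HP. induction 1 as [|X k y _ IH Hk Hy]; [apply graded_const, HP|].
  apply graded_plus; [exact IH|]. apply graded_mono.
  eapply tspan_incl; [|exact Hy]. simpl; tauto.
Qed.

Lemma correction_O P w X : correction P w X -> O_eps 1 X.
Proof.
  induction 1 as [|X k y _ IH Hk Hy]; [apply O_eps_zero|].
  apply O_eps_plus; [exact IH|]. apply (O_eps_le k); [exact Hk|].
  eapply O_eps_pow_bounded, tspan_bounded, Hy.
Qed.

Lemma correction_Cstrip P w X k r : correction P w X -> Cstrip k r X.
Proof.
  induction 1 as [|X i y _ IH Hi Hy]; [apply Cstrip_const|].
  apply Cstrip_plus; [exact IH|]. apply Cstrip_mult; [apply Cstrip_pow|].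
  eapply tspan_Cstrip, Hy.
Qed.

Lemma correction_periodic P w X e : correction P w X -> periodic (slice X e).
Proof.
  unfold slice. induction 1 as [|X i y _ IH Hi Hy]; intros t; [reflexivity|].
  simpl. rewrite IH, (tspan_periodic _ _ Hy). reflexivity.
Qed.

Lemma correction_derive P w X : correction P w X ->
  exists X', O_eps 1 X' /\ (forall e, periodic (slice X' e)) /\
    forall t e, is_derive (slice X e) t (X' t e).
Proof.
  induction 1 as [|X i y _ (X' & H1 & Hp & D) Hi Hy].
  - exists (fun _ _ => 0). split; [apply O_eps_zero|].
    split; [intros e t; reflexivity|intros; apply @is_derive_const].
  - destruct (tspan_Derive _ _ Hy) as [Hy' Dy].
    exists (fun t e => X' t e + e ^ i * Derive y t). split; [|split].
    + apply O_eps_plus; [exact H1|]. apply (O_eps_le i); [exact Hi|].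
      eapply O_eps_pow_bounded, tspan_bounded, Hy'.
    + intros e t. unfold slice in *. rewrite Hp, (tspan_periodic _ _ Hy'). reflexivity.
    + intros t e. apply (is_derive_plus (slice X e) (fun t => e ^ i * y t)); [apply D|].
      apply is_derive_scal, Dy.
Qed.

(** * Sums over orbits of the rotation by omega, and the action *)

Lemma sum_telescope (F : R -> R) w t n :
  sum_n (fun j => F (t + INR j * w + w) - F (t + INR j * w)) n = F (t + INR (S n) * w) - F t.
Proof.
  induction n as [|n IH].
  - rewrite sum_O. simpl. replace (t + 0 * w) with t by ring. now rewrite Rmult_1_l.
  - rewrite sum_Sn, IH. rewrite (S_INR (S n)).
    replace (t + (INR (S n) + 1) * w) with (t + INR (S n) * w + w) by ring.
    real_ring.
Qed.

Lemma sum_telescope_periodic (F : R -> R) p q t : (1 <= q)%nat -> periodic F ->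
  sum_n (fun j => F (t + INR j * omega p q + omega p q) - F (t + INR j * omega p q)) (pred q) = 0.
Proof.
  intros Hq HF. rewrite sum_telescope. replace (S (pred q)) with q by lia.
  replace (t + INR q * omega p q) with (t + 2 * PI * IZR (Z.of_nat p)).
  - rewrite periodic_IZR by exact HF. apply Rminus_diag.
  - rewrite <- INR_IZR_INZ. unfold omega. field. apply not_0_INR. lia.
Qed.

(** Such a g is a second difference of a periodic function, and q steps of omega make p full turns,
    so the orbit sum telescopes to 0. *)
Lemma tspan_mean_zero p q g t : (1 <= q)%nat ->
  tspan (fun l => cos (INR l * omega p q) <> 1) g ->
  sum_n (fun j => g (t + INR j * omega p q)) (pred q) = 0.
Proof.
  intros Hq Hg. set (w := omega p q) in *.
  destruct (tspan_second_difference _ w g (fun l H => H) Hg) as [y [Hy E]].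
  rewrite <- (sum_telescope_periodic (fun s => y (s + w) - y s) p q t Hq).
  - apply sum_n_ext. intros j. fold w. rewrite <- E.
    replace (t + INR j * w + 2 * w) with (t + INR j * w + w + w) by ring. real_ring.
  - pose proof (tspan_periodic _ _ Hy) as Hp. intros s.
    replace (s + 2 * PI + w) with (s + w + 2 * PI) by ring. now rewrite !Hp.
Qed.

Lemma correction_mean_zero P p q X t e : (1 <= q)%nat -> correction P (omega p q) X ->
  sum_n (fun j => X (t + INR j * omega p q) e) (pred q) = 0.
Proof.
  intros Hq. induction 1 as [|X i y _ IH Hi Hy].
  - rewrite sum_n_const. apply Rmult_0_r.
  - rewrite (sum_n_ext _ (fun j => plus (X (t + INR j * omega p q) e)
      (mult (e ^ i) (y (t + INR j * omega p q))))) by reflexivity.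
    rewrite sum_n_plus, (sum_n_mult_l (K := R_Ring)), IH, tspan_mean_zero; [|exact Hq|].
    + change mult with Rmult. real_ring.
    + eapply tspan_incl; [|exact Hy]. simpl; tauto.
Qed.

(* [A_eps{phi} = 2 q mu{h o psi . sin theta}]. *)
Definition action (h : R -> R -> R) (p q : nat) (X : R -> R -> R) (t e : R) : R :=
  let w := omega p q in
  sum_n (fun j => 2 * (h (impact w X (t + INR j * w) e) e
                       * sin (incidence w X (t + INR j * w) e))) (pred q).

Lemma impact_periodic w X e t : periodic (slice X e) ->
  impact w X (t + 2 * PI) e = impact w X t e + 2 * PI.
Proof.
  unfold slice, impact. intros H. replace (t + 2 * PI + w) with (t + w + 2 * PI) by ring.
  rewrite !H. ring.
Qed.

Lemma incidence_periodic w X e t : periodic (slice X e) ->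
  incidence w X (t + 2 * PI) e = incidence w X t e.
Proof.
  unfold slice, incidence. intros H. replace (t + 2 * PI + w) with (t + w + 2 * PI) by ring.
  now rewrite !H.
Qed.

Lemma action_periodic h p q X e :
  periodic (slice h e) -> periodic (slice X e) -> periodic (slice (action h p q X) e).
Proof.
  intros Hh HX t. unfold slice, action. apply sum_n_ext. intros j.
  replace (t + 2 * PI + INR j * omega p q) with (t + INR j * omega p q + 2 * PI) by ring.
  rewrite impact_periodic, incidence_periodic by exact HX.
  change (h (impact (omega p q) X (t + INR j * omega p q) e + 2 * PI) e)
    with (slice h e (impact (omega p q) X (t + INR j * omega p q) e + 2 * PI)).
  now rewrite Hh.
Qed.

Lemma lambda_in_periodic h w X e : (forall s, ex_derive (slice h e) s) ->
  periodic (slice h e) -> periodic (slice X e) -> periodic (slice (lambda_in h w X) e).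
Proof.
  intros D Hh HX t. unfold slice at 1 2, lambda_in.
  rewrite impact_periodic, incidence_periodic by exact HX.
  rewrite (periodic_is_derive _ _ Hh (fun s => Derive_correct _ s (D s))).
  change (h (impact w X t e + 2 * PI) e) with (slice h e (impact w X t e + 2 * PI)).
  now rewrite Hh.
Qed.

(** 2 h(psi) sin theta is a generating function of the billiard map: its differential is lambda1
    dphi1 - lambda dphi. The factors 1 + X' are the derivatives of phi. *)
Lemma is_derive_summand h w X X' t e :
  (forall s, ex_derive (slice h e) s) -> (forall t, is_derive (slice X e) t (X' t e)) ->
  is_derive (fun t => 2 * (h (impact w X t e) e * sin (incidence w X t e))) t
    ((1 + X' (t + w) e) * lambda_out h w X t e - (1 + X' t e) * lambda_in h w X t e).
Proof.
  intros Dh DX.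
  pose proof (is_derive_shift _ w t _ (DX (t + w))) as DXw.
  assert (Di : is_derive (fun t => impact w X t e) t (1 + (X' (t + w) e + X' t e) / 2)).
  { apply (is_derive_plus (fun t => t) (fun t => (X (t + w) e + X t e) / 2));
      [apply @is_derive_id|].
    apply (is_derive_ext (fun t => / 2 * (X (t + w) e + X t e)));
      [intros; apply Rmult_comm|].
    unfold Rdiv. rewrite Rmult_comm. apply is_derive_scal.
    apply (is_derive_plus (fun t => X (t + w) e) (slice X e)); [exact DXw|apply DX]. }
  assert (Dn : is_derive (fun t => incidence w X t e) t ((X' (t + w) e - X' t e) / 2)).
  { rewrite <- (Rplus_0_l (_ / 2)).
    apply (is_derive_plus (fun t => w / 2) (fun t => (X (t + w) e - X t e) / 2));
      [apply @is_derive_const|].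
    apply (is_derive_ext (fun t => / 2 * (X (t + w) e - X t e)));
      [intros; apply Rmult_comm|].
    unfold Rdiv. rewrite Rmult_comm. apply is_derive_scal.
    apply (is_derive_minus (fun t => X (t + w) e) (slice X e)); [exact DXw|apply DX]. }
  evar_last.
  - apply is_derive_scal. apply (is_derive_mult (fun t => h (impact w X t e) e)
      (fun t => sin (incidence w X t e))).
    + apply (is_derive_comp (slice h e) (fun t => impact w X t e)); [|exact Di].
      apply Derive_correct, Dh.
    + apply (is_derive_comp sin (fun t => incidence w X t e)); [|exact Dn].
      apply is_derive_sin.
    + intros; apply Rmult_comm.
  - unfold lambda_in, lambda_out. change plus with Rplus. change mult with Rmult.
    change scal with Rmult. simpl. unfold slice. field.
Qed.

Lemma is_derive_action h p q X X' t e : (1 <= q)%nat ->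
  periodic (slice h e) -> periodic (slice X e) -> periodic (slice X' e) ->
  (forall s, ex_derive (slice h e) s) -> (forall t, is_derive (slice X e) t (X' t e)) ->
  is_derive (slice (action h p q X) e) t
    (sum_n (fun j => (1 + X' (t + INR j * omega p q + omega p q) e)
                     * defect h (omega p q) X (t + INR j * omega p q) e) (pred q)).
Proof.
  intros Hq Hh HX HX' Dh DX. set (w := omega p q).
  evar_last.
  - apply (is_derive_sum (fun j t => 2 * (h (impact w X (t + INR j * w) e) e
                       * sin (incidence w X (t + INR j * w) e)))).
    intros j _. apply (is_derive_shift (fun t => 2 * (h (impact w X t e) e * sin (incidence w X t e)))).
    apply is_derive_summand; eassumption.
  - fold (sum_n (fun j => (1 + X' (t + INR j * w + w) e) * lambda_out h w X (t + INR j * w) e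
      - (1 + X' (t + INR j * w) e) * lambda_in h w X (t + INR j * w) e) (pred q)).
    (* The zero is written as a telescoping sum, which moves phi' lambda_in from t + j w to t + (j +
       1) w, where it pairs with phi' lambda_out to form the defect. *)
    rewrite <- (Rplus_0_r (sum_n (fun j => (1 + X' _ e) * _) _)).
    rewrite <- (sum_telescope_periodic (fun s => (1 + X' s e) * lambda_in h w X s e) p q t Hq).
    + fold w. rewrite <- (sum_n_plus (G := R_AbelianMonoid)). apply sum_n_ext. intros j. unfold defect. real_ring.
    + pose proof (lambda_in_periodic h w X e Dh Hh HX) as Hl. intros s. unfold slice in Hl, HX'.
      now rewrite Hl, HX'.
Qed.

Definition regular_support (e0 : R) (h : R -> R -> R) : Prop :=
  0 < e0 /\
  (forall e, Rabs e < e0 -> periodic (slice h e)) /\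
  (forall e s, Rabs e < e0 -> ex_derive (slice h e) s).

(** Rolle's theorem for the action over one period. *)
Lemma action_critical_point h p q X X' e : (1 <= q)%nat ->
  periodic (slice h e) -> periodic (slice X e) -> periodic (slice X' e) ->
  (forall s, ex_derive (slice h e) s) -> (forall t, is_derive (slice X e) t (X' t e)) ->
  exists t, sum_n (fun j => (1 + X' (t + INR j * omega p q + omega p q) e)
                     * defect h (omega p q) X (t + INR j * omega p q) e) (pred q) = 0.
Proof.
  intros Hq Hh HX HX' Dh DX.
  pose proof (fun t => is_derive_action h p q X X' t e Hq Hh HX HX' Dh DX) as D.
  destruct (MVT_gen _ 0 (2 * PI) _ (fun t _ => D t)) as [t [_ E]].
  - intros t _. apply derivable_continuous_pt. eexists. apply is_derive_Reals, D.
  - exists t. apply Rmult_eq_reg_r with (2 * PI - 0); [|pose proof PI_RGT_0; lra].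
    rewrite <- E. rewrite <- (Rplus_0_l (2 * PI)) at 1.
    rewrite (action_periodic h p q X e Hh HX 0). ring.
Qed.

(* Otherwise [sum_j phi'(t + (j+1) w) * defect(t + j w)], which is the derivative of the
   periodic function [action], would have no zero for small [e <> 0]. *)
Lemma constant_term_vanishes e0 h P p q X k c g : (1 <= q)%nat ->
  regular_support e0 h -> correction P (omega p q) X ->
  O_eps k (defect h (omega p q) X) ->
  tspan (fun l => cos (INR l * omega p q) <> 1) g ->
  O_eps (S k) (fun t e => defect h (omega p q) X t e - e ^ k * (c + g t)) ->
  c = 0.
Proof.
  intros Hq (He0 & Hper & Hder) HX HO Hg Hlead. set (w := omega p q) in *.
  destruct (correction_derive P w X HX) as (X' & HX'1 & HX'p & DX).
  assert (HS : O_eps (S k) (fun t e =>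
    sum_n (fun j => (1 + X' (t + INR j * w + w) e) * defect h w X (t + INR j * w) e) (pred q)
      - INR q * c * e ^ k)).
  (* The product X' times the defect gains an order; the leading coefficient c + g sums to q c over
     the orbit, as g has zero orbit mean. *)
  { apply (O_eps_ext _ _ (fun t e => sum_n (fun j =>
      X' (t + INR j * w + w) e * defect h w X (t + INR j * w) e
      + (defect h w X (t + INR j * w) e - e ^ k * (c + g (t + INR j * w)))) (pred q))).
    - intros t e.
      assert (Ec : sum_n (fun j => e ^ k * (c + g (t + INR j * w))) (pred q) = INR q * c * e ^ k).
      { rewrite (sum_n_ext _ (fun j => mult (e ^ k) (plus c (g (t + INR j * w))))) by reflexivity.
        rewrite (sum_n_mult_l (K := R_Ring)), sum_n_plus, sum_n_const.
        replace (S (pred q)) with q by lia.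
        pose proof (tspan_mean_zero p q g t Hq Hg) as Z.
        change (e ^ k * (INR q * c + sum_n (fun j => g (t + INR j * omega p q)) (pred q))
          = INR q * c * e ^ k).
        rewrite Z. ring. }
      rewrite <- Ec.
      rewrite (sum_n_ext (fun j => (1 + _) * _) (fun j => plus
        (X' (t + INR j * w + w) e * defect h w X (t + INR j * w) e
          + (defect h w X (t + INR j * w) e - e ^ k * (c + g (t + INR j * w))))
        (e ^ k * (c + g (t + INR j * w))))).
      + rewrite sum_n_plus. change plus with Rplus.
        assert (Hxy : forall x y : R, x + y - y = x) by (intros; ring). apply Hxy.
      + intros j. real_ring.
    - apply (O_eps_sum (S k) (fun j t e =>
      X' (t + INR j * w + w) e * defect h w X (t + INR j * w) e
      + (defect h w X (t + INR j * w) e - e ^ k * (c + g (t + INR j * w))))).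
      intros j _. apply O_eps_plus.
      + apply (O_eps_mult 1 k).
        * apply (O_eps_comp _ _ (fun t _ => t + INR j * w + w) HX'1).
        * apply (O_eps_comp _ _ (fun t _ => t + INR j * w) HO).
      + apply (O_eps_comp _ _ (fun t _ => t + INR j * w) Hlead). }
  assert (Hc : O_eps (S k) (fun _ e => INR q * c * e ^ k)).
  { destruct HS as [K HK]. exists K.
    generalize (filter_and _ _ HK (locally_0_Rabs_lt e0 He0)); apply filter_imp.
    intros e [H He] _.
    (* The zero t depends on e, which is allowed because the bound is uniform in t. *)
    destruct (action_critical_point h p q X X' e Hq) as [t Ht]; auto.
    - eapply correction_periodic, HX.
    - specialize (H t). fold w in Ht. rewrite Ht in H.
      rewrite <- Rabs_Ropp. replace (- (INR q * c * e ^ k)) with (0 - INR q * c * e ^ k) by ring.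
      exact H. }
  apply O_eps_pow_const in Hc. apply Rmult_integral in Hc.
  destruct Hc as [Hc|Hc]; [|exact Hc]. exfalso. revert Hc. apply not_0_INR. lia.
Qed.

Lemma correction_exists e0 h P p q m : (1 <= q)%nat ->
  sin (omega p q / 2) <> 0 ->
  grading P -> graded_support P h -> regular_support e0 h ->
  (forall k l, (1 <= k <= m)%nat -> P k l -> l <> 0%nat -> cos (INR l * omega p q) <> 1) ->
  exists X, correction P (omega p q) X /\ O_eps (S m) (defect h (omega p q) X).
Proof.
  intros Hq Hsin HP Hh Hreg. set (w := omega p q) in *.
  induction m as [|k IH]; intros Hres.
  - exists (fun _ _ => 0). split; [apply correction_zero|apply (defect_circle P h w Hh)].
  - destruct IH as [X [HX HO]]; [intros i l Hi; apply Hres; lia|].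
    destruct (graded_leading P (S k) (defect h w X)) as [a [Ha Ea]].
    { apply graded_defect; auto; [eapply correction_graded|eapply correction_O]; eassumption. }
    { exact HO. }
    destruct (tspan_split_constant _ a Ha) as (c & g & Hg & Eg).
    assert (Hg' : tspan (fun l => P (S k) l /\ cos (INR l * w) <> 1) g).
    { eapply tspan_incl; [|exact Hg]. intros l [Hl Hl0]. split; [exact Hl|].
      apply (Hres (S k)); auto; lia. }
    assert (Hc : c = 0).
    { apply (constant_term_vanishes e0 h P p q X (S k) c g); auto.
      - eapply tspan_incl; [|exact Hg']. simpl; tauto.
      - eapply O_eps_ext; [|exact Ea]. intros t e. simpl. now rewrite Eg. }
    (* The factor - 2 / sin (w / 2) undoes the coefficient sin (w / 2) / 2 of [defect_perturbation],
       so that the new term cancels g. *)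
    destruct (tspan_second_difference (fun l => P (S k) l /\ cos (INR l * w) <> 1) w
      (fun t => - (2 / sin (w / 2)) * g t)) as [y [Hy Ey]].
    { tauto. } { apply tspan_scal, Hg'. }
    exists (fun t e => X t e + e ^ S k * y t). split; [apply correction_plus; auto; lia|].
    eapply O_eps_near; [exact Ea|].
    eapply O_eps_ext; [|apply (defect_perturbation P _ h w X (S k) y Hh (correction_O _ _ _ HX)
      ltac:(lia) Hy)].
    intros t e. simpl. rewrite Ey, Eg, Hc. field. exact Hsin.
Qed.

(** * The billiard map near the circle *)

Lemma curve_coordinates g s :
  curve g s = (g s * cos s - Derive g s * sin s, g s * sin s + Derive g s * cos s).
Proof.
  unfold curve, cis, RtoC, Cmult, Cplus. simpl.
  rewrite cos_plus, sin_plus, cos_PI2, sin_PI2. f_equal; ring.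
Qed.

Lemma on_line_curve g phi l s :
  on_line (phi, l) (curve g s) <-> g s * cos (s - phi) - Derive g s * sin (s - phi) = l.
Proof.
  unfold on_line. rewrite curve_coordinates. unfold Re, Im. simpl fst. simpl snd.
  rewrite cos_minus, sin_minus. split; intros <-; ring.
Qed.

Lemma cis_plus a b : cis (a + b) = (cis a * cis b)%C.
Proof. unfold cis, Cmult. simpl. rewrite cos_plus, sin_plus. f_equal. ring. Qed.

Lemma Cconj_cis a : Cconj (cis a) = cis (- a).
Proof. unfold Cconj, cis. simpl. now rewrite cos_neg, sin_neg. Qed.

Lemma reflected_line_tangent g s theta l :
  reflected_line g s (s - theta, l)
    (s + theta, g s * cos theta + Derive g s * sin theta).
Proof.
  split.
  - apply on_line_curve. replace (s - (s + theta)) with (- theta) by ring.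
    rewrite cos_neg, sin_neg. ring.
  - unfold line_dir. simpl fst. rewrite Cconj_cis, <- !cis_plus. f_equal. ring.
Qed.

(** cos phi Im z - sin phi Re z is the coordinate of z along the line, so the order of two
    intersections is read from it. *)
Lemma on_line_chord phi l z z' : on_line (phi, l) z -> on_line (phi, l) z' ->
  z = (z' + RtoC ((cos phi * Im z - sin phi * Re z) - (cos phi * Im z' - sin phi * Re z'))
            * line_dir (phi, l))%C.
Proof.
  destruct z as [x y], z' as [x' y'].
  unfold on_line, line_dir, cis, Re, Im, Cplus, Cmult, RtoC. simpl. intros H H'.
  rewrite cos_plus, sin_plus, cos_PI2, sin_PI2.
  pose proof (sin2_cos2 phi) as Hsc. unfold Rsqr in Hsc.
  set (c := cos phi) in *. set (s := sin phi) in *.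
  assert (H0 : c * (x - x') + s * (y - y') = 0) by lra.
  f_equal.
  - assert (x - x' = (s * s + c * c) * (x - x')) by (rewrite Hsc; ring).
    assert (c * (c * (x - x') + s * (y - y')) = 0) by (rewrite H0; ring). lra.
  - assert (y - y' = (s * s + c * c) * (y - y')) by (rewrite Hsc; ring).
    assert (s * (c * (x - x') + s * (y - y')) = 0) by (rewrite H0; ring). lra.
Qed.

Lemma chord_coordinate g phi s :
  cos phi * Im (curve g s) - sin phi * Re (curve g s)
  = g s * sin (s - phi) + Derive g s * cos (s - phi).
Proof.
  rewrite curve_coordinates. unfold Re, Im. simpl. rewrite cos_minus, sin_minus. ring.
Qed.

Definition near_circle (d : R) (g : R -> R) : Prop :=
  forall s, Rabs (g s - 1) < d /\ Rabs (Derive g s) < d.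

Lemma mult_bounded_l x y d : Rabs x < d -> Rabs y <= 1 -> - d < x * y < d.
Proof.
  intros Hx Hy. apply Rabs_lt_between. rewrite Rabs_mult.
  apply Rle_lt_trans with (Rabs x * 1); [|lra].
  apply Rmult_le_compat_l; [apply Rabs_pos|exact Hy].
Qed.

Lemma near_circle_cos d g s x : near_circle d g ->
  - (2 * d) < g s * cos x - Derive g s * sin x - cos x < 2 * d.
Proof.
  intros H. destruct (H s) as [H1 H2].
  pose proof (mult_bounded_l _ (cos x) _ H1 (Rabs_le _ _ (COS_bound x))).
  pose proof (mult_bounded_l _ (sin x) _ H2 (Rabs_le _ _ (SIN_bound x))). lra.
Qed.

Lemma near_circle_sin d g s x : near_circle d g ->
  - (2 * d) < g s * sin x + Derive g s * cos x - sin x < 2 * d.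
Proof.
  intros H. destruct (H s) as [H1 H2].
  pose proof (mult_bounded_l _ (sin x) _ H1 (Rabs_le _ _ (SIN_bound x))).
  pose proof (mult_bounded_l _ (cos x) _ H2 (Rabs_le _ _ (COS_bound x))). lra.
Qed.

(** Here a stands for w / 2. The lower bounds on 1 - cos a, on cos a and on 1 keep the line in the
    phase space; 5 d <= sin a separates exit from entry: the exit has chord coordinate above 2 d,
    the entry below d. *)
Lemma billiard_map_near_circle d a g s theta :
  periodic g -> (forall s, ex_derive g s) -> (forall s, continuity_pt (Derive g) s) ->
  near_circle d g -> Rabs (theta - a) < d ->
  4 * d <= 1 - cos a -> 0 <= cos a -> 4 * d <= 1 -> 5 * d <= sin a ->
  billiard_map g (s - theta, g s * cos theta - Derive g s * sin theta)
    (s + theta, g s * cos theta + Derive g s * sin theta).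
Proof.
  intros Hp D Dc Hg Hth H1 H2 H3 H4.
  set (phi := s - theta). set (l := g s * cos theta - Derive g s * sin theta).
  pose proof (cos_lipschitz theta a) as Lc. pose proof (sin_lipschitz theta a) as Ls.
  assert (Hc : Rabs (cos theta - cos a) < d) by lra.
  assert (Hs : Rabs (sin theta - sin a) < d) by lra.
  apply Rabs_def2 in Hc. apply Rabs_def2 in Hs.
  pose proof (near_circle_cos d g s theta Hg) as Hl. fold l in Hl.
  assert (HA : in_A g (phi, l)).
  { unfold in_A. simpl. destruct (Hg phi) as [Hg1 _]. destruct (Hg (phi + PI)) as [Hg2 _].
    apply Rabs_def2 in Hg1. apply Rabs_def2 in Hg2. lra. }
  split; [exact HA|]. exists s. split; [|apply reflected_line_tangent].
  assert (Hon : on_line (phi, l) (curve g s)).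
  { apply on_line_curve. unfold phi, l. now replace (s - (s - theta)) with theta by ring. }
  split; [exact Hon|].
  (* F x = l exactly when [curve g x] lies on the line. F runs from -g(phi + pi) at phi - pi to
     g(phi) at phi, and l lies between these by [in_A]. *)
  set (F := fun x => g x * cos (x - phi) - Derive g x * sin (x - phi)).
  assert (HF : continuity F).
  { intros x. unfold F.
    assert (Cg : continuity_pt g x).
    { apply derivable_continuous_pt. exists (Derive g x). apply is_derive_Reals, Derive_correct, D. }
    assert (Cs : continuity_pt (fun x => x - phi) x)
      by (apply derivable_continuous_pt; exists (1 - 0); apply derivable_pt_lim_minus;
          [apply derivable_pt_lim_id|apply derivable_pt_lim_const]).
    apply (continuity_pt_minus (fun x => g x * cos (x - phi)) (fun x => Derive g x * sin (x - phi))).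
    - apply (continuity_pt_mult g (fun x => cos (x - phi))); [exact Cg|].
      apply (continuity_pt_comp (fun x => x - phi) cos); [exact Cs|apply continuity_cos].
    - apply (continuity_pt_mult (Derive g) (fun x => sin (x - phi))); [apply Dc|].
      apply (continuity_pt_comp (fun x => x - phi) sin); [exact Cs|apply continuity_sin]. }
  unfold in_A in HA. simpl in HA. pose proof PI_RGT_0 as Hpi.
  assert (F1 : F phi = g phi) by (unfold F; rewrite Rminus_diag, cos_0, sin_0; ring).
  assert (F2 : F (phi - PI) = - g (phi + PI)).
  { unfold F. replace (phi - PI - phi) with (- PI) by ring.
    rewrite cos_neg, sin_neg, cos_PI, sin_PI.
    replace (phi + PI) with (phi - PI + 2 * PI) by ring. rewrite Hp. ring. }
  destruct (IVT_gen F (phi - PI) phi l HF) as [s' [Hs' Es']].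
  { rewrite F1, F2, Rmin_left, Rmax_right by lra. lra. }
  rewrite Rmin_left, Rmax_right in Hs' by lra.
  exists s'. eexists. split; [|apply on_line_chord; [exact Hon|apply on_line_curve, Es']].
  rewrite !chord_coordinate.
  pose proof (near_circle_sin d g s theta Hg) as B1.
  replace (s - phi) with theta by (unfold phi; ring).
  destruct (Hg s') as [G1 G2]. apply Rabs_def2 in G1.
  pose proof (mult_bounded_l _ (cos (s' - phi)) _ G2 (Rabs_le _ _ (COS_bound (s' - phi)))).
  (* The entry point was sought in [phi - pi, phi] for this sign: the main part g sin of its chord
     coordinate is then nonpositive. *)
  assert (sin (s' - phi) <= 0).
  { rewrite <- (Ropp_involutive (s' - phi)), sin_neg.
    assert (0 <= sin (- (s' - phi))) by (apply sin_ge_0; lra). lra. }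
  assert (g s' * sin (s' - phi) <= 0) by nra.
  lra.
Qed.

(** * Persistence *)

Lemma locally_0_closed_interval r (Q : R -> Prop) : 0 < r -> locally 0 Q ->
  exists e1, 0 < e1 < r /\ forall e, Rabs e <= e1 -> Q e.
Proof.
  intros Hr [d Hd]. pose proof (cond_pos d). exists (Rmin (d / 2) (r / 2)).
  pose proof (Rmin_l (d / 2) (r / 2)). pose proof (Rmin_r (d / 2) (r / 2)).
  split; [split; [apply Rmin_pos; lra|lra]|].
  intros e He. apply Hd. unfold ball; simpl; unfold AbsRing_ball, abs, minus, plus, opp; simpl.
  rewrite Ropp_0, Rplus_0_r. lra.
Qed.

Lemma deformation_regular e0 h hk : deformation e0 h hk -> regular_support e0 h.
Proof.
  intros (He0 & Hs & Hc & _). split; [exact He0|]. split.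
  - intros e He. apply Hc. lra.
  - intros e s He. destruct (Ck_Cstrip 1 _ _ (Hs 1%nat)) as [_ (ht & _ & D & _)].
    exists (ht s e). apply D, He.
Qed.

Lemma Cstrip_shift k r w X : Cstrip k r X -> Cstrip k r (fun t e => X (t + w) e).
Proof.
  intros H. apply (Cstrip_comp k r X (fun t _ => t + w) H).
  apply Cstrip_plus; [apply Cstrip_t|apply Cstrip_const].
Qed.

Lemma Cstrip_impact k r w X : Cstrip k r X -> Cstrip k r (impact w X).
Proof.
  intros H. apply Cstrip_plus; [apply Cstrip_t|].
  apply (Cstrip_mult k r (fun t e => X (t + w) e + X t e)); [|apply Cstrip_const].
  apply Cstrip_plus; [apply Cstrip_shift|]; exact H.
Qed.

Lemma Cstrip_incidence k r w X : Cstrip k r X -> Cstrip k r (incidence w X).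
Proof.
  intros H. apply Cstrip_plus; [apply Cstrip_const|].
  apply (Cstrip_mult k r (fun t e => X (t + w) e - X t e)); [|apply Cstrip_const].
  apply Cstrip_minus; [apply Cstrip_shift|]; exact H.
Qed.

Lemma Cstrip_lambda_in k r h w X : Cstrip (S k) r h -> Cstrip k r X ->
  Cstrip k r (lambda_in h w X).
Proof.
  intros Hh HX. apply Cstrip_minus; apply Cstrip_mult.
  - apply (Cstrip_comp k r h); [apply Cstrip_S, Hh|apply Cstrip_impact, HX].
  - apply Cstrip_cos, Cstrip_incidence, HX.
  - apply (Cstrip_comp k r (fun s e => Derive (slice h e) s));
      [apply Cstrip_Derive, Hh|apply Cstrip_impact, HX].
  - apply Cstrip_sin, Cstrip_incidence, HX.
Qed.

Lemma sum_n_affine (u v : nat -> R) (a b c : R) n :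
  sum_n (fun j => a + b * u j + c * v j) n = INR (S n) * a + b * sum_n u n + c * sum_n v n.
Proof.
  induction n as [|n IH].
  - rewrite !sum_O. simpl. real_ring.
  - rewrite !sum_Sn, IH, (S_INR (S n)). real_ring.
Qed.

(** The three normalizations of (F) all have this shape: X has zero orbit mean, so only the constant
    remains. *)
Lemma mu_correction P p q X a b c f t e : (1 <= q)%nat -> correction P (omega p q) X ->
  (forall s, f s = a + b * X (s + omega p q) e + c * X s e) ->
  mu q (omega p q) f t = a.
Proof.
  intros Hq HX E. unfold mu.
  rewrite (sum_n_ext _ (fun j => a + b * X (t + omega p q + INR j * omega p q) e
    + c * X (t + INR j * omega p q) e)).
  - rewrite (sum_n_affine (fun j => X (t + omega p q + INR j * omega p q) e)
      (fun j => X (t + INR j * omega p q) e)).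
    rewrite !(correction_mean_zero P p q X _ e Hq HX).
    replace (S (pred q)) with q by lia. field. apply not_0_INR. lia.
  - intros j. rewrite E. do 4 f_equal. ring.
Qed.

(** For (A): the action differs from its value at t = 0, which serves as L(eps), by at most its
    derivative times a period. *)
Lemma O_eps_variation k F F' r : 0 < r -> (forall e, Rabs e < r -> periodic (slice F e)) ->
  (forall t e, Rabs e < r -> is_derive (slice F e) t (F' t e)) ->
  O_eps k F' -> O_eps k (fun t e => F t e - F 0 e).
Proof.
  intros Hr Hp D [K HK]. exists (K * (2 * PI)).
  generalize (filter_and _ _ HK (locally_0_Rabs_lt r Hr)); apply filter_imp.
  intros e [H He] t. destruct (mod_2PI t) as [z Hz].
  change (F t e - F 0 e) with (slice F e t - slice F e 0).
  rewrite <- (periodic_IZR (slice F e) z t (Hp e He)).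
  eapply Rle_trans; [apply (bounded_derive_lipschitz (slice F e) (slice F' e) (K * Rabs e ^ k));
    [intros; apply D, He|exact H]|].
  replace (K * (2 * PI) * Rabs e ^ k) with (K * Rabs e ^ k * (2 * PI)) by ring.
  apply Rmult_le_compat_l.
  - eapply Rle_trans; [apply Rabs_pos|apply (H 0)].
  - rewrite Rminus_0_r, Rabs_pos_eq; lra.
Qed.

Lemma persists_of_correction e0 h hk P p q m X :
  (0 < p)%nat -> (2 * p < q)%nat ->
  deformation e0 h hk -> graded_support P h ->
  correction P (omega p q) X -> O_eps (S m) (defect h (omega p q) X) ->
  persists e0 h p q m.
Proof.
  intros Hp Hpq Hdef HG HX HO.
  pose proof (deformation_regular _ _ _ Hdef) as (He0 & Hper & Hder).
  destruct Hdef as (_ & Hsm & Hconv & _).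
  assert (Hq : (1 <= q)%nat) by lia.
  assert (Hh : forall k, Cstrip k e0 h) by (intros k; apply Ck_Cstrip, Hsm).
  assert (HXs : forall k, Cstrip k e0 X) by (intros k; eapply correction_Cstrip, HX).
  destruct (correction_derive P _ X HX) as (X' & HX'1 & HX'p & DX).
  pose proof (correction_O _ _ _ HX) as HX1.
  pose proof (fun e => correction_periodic _ _ X e HX) as HXp.
  set (w := omega p q) in *.
  assert (Hw : 0 < w / 2 < PI / 2).
  { pose proof PI_RGT_0 as Hpi. pose proof (lt_0_INR p Hp) as Hp'.
    pose proof (lt_INR _ _ Hpq) as Hpq'. rewrite mult_INR in Hpq'. simpl in Hpq'.
    assert (Hr : 0 < INR p / INR q < / 2).
    { split; [apply Rdiv_lt_0_compat; lra|].
      apply Rmult_lt_reg_r with (INR q); [lra|]. unfold Rdiv. rewrite Rmult_assoc, Rinv_l; lra. }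
    replace (w / 2) with (PI * (INR p / INR q)) by (unfold w, omega; field; lra). nra. }
  assert (Hsin : 0 < sin (w / 2)) by (apply sin_gt_0; lra).
  assert (Hcos : 0 < cos (w / 2)) by (apply cos_gt_0; lra).
  assert (Hcos1 : cos (w / 2) < 1).
  { pose proof (sin2_cos2 (w / 2)) as E. unfold Rsqr in E. nra. }
  (* The largest d compatible with the three inequalities of [billiard_map_near_circle] for a = w /
     2. *)
  pose (d := Rmin (/ 4) (Rmin ((1 - cos (w / 2)) / 4) (sin (w / 2) / 5))).
  assert (Hd : 0 < d /\ 4 * d <= 1 /\ 4 * d <= 1 - cos (w / 2) /\ 5 * d <= sin (w / 2)).
  { pose proof (Rmin_l (/ 4) (Rmin ((1 - cos (w / 2)) / 4) (sin (w / 2) / 5))).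
    pose proof (Rmin_r (/ 4) (Rmin ((1 - cos (w / 2)) / 4) (sin (w / 2) / 5))).
    pose proof (Rmin_l ((1 - cos (w / 2)) / 4) (sin (w / 2) / 5)).
    pose proof (Rmin_r ((1 - cos (w / 2)) / 4) (sin (w / 2) / 5)).
    unfold d in *. split; [|lra]. repeat apply Rmin_pos; lra. }
  destruct Hd as (Hd0 & Hd1 & Hd2 & Hd3).
  assert (HI1 : O_eps 1 (fun t e => incidence w X t e - w / 2)).
  { apply (O_eps_ext _ _ (fun t e => / 2 * (X (t + w) e - X t e))).
    - intros; unfold incidence; field.
    - apply O_eps_scal, O_eps_minus; [apply (O_eps_comp _ _ (fun t _ => t + w) HX1)|exact HX1]. }
  (* |X'| < 1 makes phi increasing and |X| < 1 makes it onto; the other bounds are those of the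
     billiard map lemma. The strict e1 < e0 is needed to pass from the open strip to [smooth e1]. *)
  destruct (locally_0_closed_interval e0 (fun e =>
    (forall t, Rabs (X t e) < 1) /\ (forall t, Rabs (X' t e) < 1) /\
    (forall s, Rabs (h s e - 1) < d) /\ (forall s, Rabs (Derive (slice h e) s) < d) /\
    (forall t, Rabs (incidence w X t e - w / 2) < d)) He0) as [e1 [He1 Hsmall]].
  { repeat apply filter_and.
    - apply (O_eps_small X 1 HX1 Rlt_0_1).
    - apply (O_eps_small X' 1 HX'1 Rlt_0_1).
    - apply (O_eps_small _ d (graded_support_1 P h HG) Hd0).
    - apply (O_eps_small _ d (graded_support_derive P h HG) Hd0).
    - apply (O_eps_small _ d HI1 Hd0). }
  pose (phi := fun t e => t - w / 2 + X t e).
  assert (Hphis : forall k, Cstrip k e0 phi).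
  { intros k. apply Cstrip_plus; [|apply HXs]. apply Cstrip_minus; [apply Cstrip_t|apply Cstrip_const]. }
  assert (Dphi : forall t e, is_derive (slice phi e) t (1 + X' t e)).
  { intros t e. apply (is_derive_plus (fun t => t - w / 2) (slice X e)); [|apply DX].
    evar_last; [apply (is_derive_minus (fun t => t) (fun _ => w / 2));
      [apply @is_derive_id|apply @is_derive_const]|]. apply Rminus_0_r. }
  assert (Hphip : forall e, periodic (fun t => phi t e - t)).
  { intros e t. pose proof (HXp e t) as E. unfold slice in E. unfold phi. rewrite E. ring. }
  exists e1. split; [lra|]. exists phi, (impact w X), (incidence w X).
  split; [|split].
  - unfold condition_F. fold w.
    split; [intros k; apply (Cstrip_Ck k e0); [lra|apply Hphis]|].
    split; [intros k; apply (Cstrip_Ck k e0); [lra|apply Cstrip_impact, HXs]|].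
    split; [intros k; apply (Cstrip_Ck k e0); [lra|apply Cstrip_incidence, HXs]|].
    split.
    + intros e He. destruct (Hsmall e He) as (_ & S2 & _).
      split; [apply Hphip|].
      split; [intros t; rewrite impact_periodic by apply HXp; ring|].
      split; [intros t; apply incidence_periodic, HXp|].
      intros t. split; [|split; [|split; [|split; [|split; [|split]]]]].
      * unfold impact, incidence, phi. field.
      * unfold impact, Defs.sigma, Defs.tau, slice, phi. field.
      * unfold incidence, Defs.delta, Defs.tau, slice, phi. field.
      * apply (mu_correction P p q X 0 (/ 2) (/ 2) _ t e Hq HX). intros s. unfold impact. fold w. field.
      * apply (mu_correction P p q X (w / 2) 0 (-1) _ t e Hq HX). intros s. unfold phi. ring.
      * apply (mu_correction P p q X (w / 2) (/ 2) (- / 2) _ t e Hq HX). intros s.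
        unfold slice, incidence. fold w. field.
      * rewrite (is_derive_unique _ _ _ (Dphi t e)). specialize (S2 t). apply Rabs_def2 in S2. lra.
    + eapply O_eps_ext; [|exact HO]. intros t e.
      unfold Defs.sigma, Defs.delta, Defs.tau, defect, lambda_in, lambda_out. ring.
  - unfold condition_P. fold w. exists (lambda_in h w X), (lambda_out h w X).
    split; [intros k; apply (Cstrip_Ck k e0); [lra|apply Hphis]|].
    split; [intros k; apply (Cstrip_Ck k e0); [lra|apply Cstrip_lambda_in; auto]|].
    split.
    + intros e He. destruct (Hsmall e He) as (S1 & S2 & S3 & S4 & S5).
      assert (He' : Rabs e < e0) by lra.
      assert (Hb : forall t, billiard_map (slice h e) (phi t e, lambda_in h w X t e)
                               (phi (t + w) e, lambda_out h w X t e)).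
      { intros t.
        replace (phi t e) with (impact w X t e - incidence w X t e)
          by (unfold impact, incidence, phi; field).
        replace (phi (t + w) e) with (impact w X t e + incidence w X t e)
          by (unfold impact, incidence, phi; field).
        apply (billiard_map_near_circle d (w / 2)); auto; try lra.
        - intros s. apply continuity_pt_filterlim.
          apply (continuous_comp_2 (fun x => x) (fun _ => e) (fun s e => Derive (slice h e) s)).
          + apply continuous_id. + apply continuous_const.
          + apply (Cstrip_continuous 0 e0 (fun s e => Derive (slice h e) s));
              [apply Cstrip_Derive, Hh|exact He'].
        - intros s. split; [apply S3|apply S4]. }
      split; [apply Hphip|]. split; [apply lambda_in_periodic; auto|].
      split; [intros t; apply Hb|]. split; [|exact Hb].
      assert (Cphi : continuity (slice phi e)).
      { intros t. apply derivable_continuous_pt. eexists. apply is_derive_Reals, Dphi. }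
      (* The graph property in (P): phi is a bijection of the line, so each abscissa carries exactly
         one value of lambda. *)
      assert (Hinj : forall s t, phi s e = phi t e -> s = t).
      { intros s t E. destruct (MVT_gen (slice phi e) s t (fun t => 1 + X' t e)) as [c [_ Ec]].
        - intros; apply Dphi.
        - intros; apply Cphi.
        - unfold slice in Ec. rewrite E, Rminus_diag in Ec. specialize (S2 c). apply Rabs_def2 in S2.
          symmetry in Ec. apply Rmult_integral in Ec. lra. }
      (* As |X| < 1, phi lies below x at x + w / 2 - 1 and above x at x + w / 2 + 1. *)
      intros x. destruct (IVT_gen (slice phi e) (x + w / 2 - 1) (x + w / 2 + 1) x Cphi) as [t [_ Et]].
      { pose proof (S1 (x + w / 2 - 1)) as A1. pose proof (S1 (x + w / 2 + 1)) as A2.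
        apply Rabs_def2 in A1. apply Rabs_def2 in A2. unfold slice, phi.
        rewrite Rmin_left, Rmax_right; lra. }
      exists (lambda_in h w X t e). split.
      * exists t. split; [exact Et|reflexivity].
      * intros y (t' & Et' & <-). f_equal. apply Hinj. now rewrite Et'.
    + exact HO.
  - unfold condition_A. fold w. exists (fun e => action h p q X 0 e). split.
    + intros e He. destruct (Hsmall e He) as (_ & _ & S3 & _ & S5).
      assert (Hpos : forall t, 0 < 2 * (h (impact w X t e) e * sin (incidence w X t e))).
      { intros t. apply Rmult_lt_0_compat; [lra|]. apply Rmult_lt_0_compat.
        - specialize (S3 (impact w X t e)). apply Rabs_def2 in S3. lra.
        - pose proof (sin_lipschitz (incidence w X t e) (w / 2)) as L. specialize (S5 t).
          assert (Hs : Rabs (sin (incidence w X t e) - sin (w / 2)) < d) by lra.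
          apply Rabs_def2 in Hs. lra. }
      unfold action. fold w. induction (pred q) as [|n IH].
      * rewrite sum_O. apply Hpos.
      * rewrite sum_Sn. apply Rplus_lt_0_compat; [exact IH|apply Hpos].
    + apply (O_eps_ext _ _ (fun t e => action h p q X t e - action h p q X 0 e)).
      * intros t e. f_equal. unfold mu, action. fold w.
        rewrite (sum_n_mult_l (K := R_Ring) 2). change mult with Rmult.
        match goal with |- _ * (_ * ?s) = _ * ?s' => change s' with s end.
        rewrite <- Rmult_assoc. f_equal. field. apply not_0_INR. lia.
      (* The derivative of the action is an orbit sum of bounded factors times the defect, so (A)
         inherits the order of (F). *)
      * apply (O_eps_variation (S m) (action h p q X) (fun t e =>
          sum_n (fun j => (1 + X' (t + INR j * w + w) e) * defect h w X (t + INR j * w) e) (pred q))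
          e0 He0).
        -- intros e He. apply action_periodic; auto.
        -- intros t e He. apply is_derive_action; auto.
        -- apply (O_eps_sum (S m) (fun j t e =>
             (1 + X' (t + INR j * w + w) e) * defect h w X (t + INR j * w) e)).
           intros j _. apply (O_eps_mult 0 (S m)).
           ++ apply O_eps_plus.
              ** apply (O_eps_bounded _ 1). intros; rewrite Rabs_R1; lra.
              ** apply (O_eps_le 1); [lia|].
                 apply (O_eps_comp _ _ (fun t _ => t + INR j * w + w) HX'1).
           ++ apply (O_eps_comp _ _ (fun t _ => t + INR j * w) HO).
Qed.

(** * Symmetries and resonant harmonics *)

Lemma tspan_sum P (f : nat -> R -> R) n : (forall j, (j <= n)%nat -> tspan P (f j)) ->
  tspan P (fun t => sum_n (fun j => f j t) n).
Proof.
  induction n as [|n IH]; intros H.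
  - apply tspan_ext with (f 0%nat); [intros t; now rewrite sum_O|apply H; lia].
  - apply tspan_ext with (fun t => sum_n (fun j => f j t) n + f (S n) t);
      [intros t; now rewrite sum_Sn|].
    apply tspan_plus; [apply IH; intros; apply H; lia|apply H; lia].
Qed.

Lemma tspan_trig_poly d g : trig_poly d g -> tspan (fun l => (l <= d)%nat) g.
Proof.
  intros (a & b & E). apply tspan_ext with (fun s => sum_n (fun j =>
    a j * cos (INR j * s) + b j * sin (INR j * s)) d); [intros; now rewrite E|].
  apply (tspan_sum _ (fun j s => a j * cos (INR j * s) + b j * sin (INR j * s))). intros j Hj.
  apply tspan_plus; [apply tspan_cos|apply tspan_sin]; exact Hj.
Qed.

Lemma cos_plus_INR_PI j x : cos (x + INR j * PI) = (-1) ^ j * cos x.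
Proof.
  induction j as [|j IH].
  - simpl. rewrite Rmult_0_l, Rplus_0_r. ring.
  - rewrite S_INR. replace (x + (INR j + 1) * PI) with (x + INR j * PI + PI) by ring.
    rewrite neg_cos, IH. simpl. ring.
Qed.

Lemma sin_plus_INR_PI j x : sin (x + INR j * PI) = (-1) ^ j * sin x.
Proof.
  induction j as [|j IH].
  - simpl. rewrite Rmult_0_l, Rplus_0_r. ring.
  - rewrite S_INR. replace (x + (INR j + 1) * PI) with (x + INR j * PI + PI) by ring.
    rewrite neg_sin, IH. simpl. ring.
Qed.

Lemma pow_m1_odd n : ~ Nat.Even n -> (-1) ^ n = -1.
Proof.
  intros H. destruct (Nat.Even_or_Odd n) as [|[x ->]]; [tauto|].
  rewrite Nat.add_1_r. apply pow_1_odd.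
Qed.

(* [g] is the mean of [g s] and [(-1)^v g (s + pi)], in which the harmonics of the wrong
   parity cancel. *)
Lemma tspan_trig_poly_parity d v g : trig_poly d g ->
  (forall s, g (s + PI) = (-1) ^ v * g s) ->
  tspan (fun l => (l <= d)%nat /\ Nat.Even (v + l)) g.
Proof.
  intros (a & b & E) Hg.
  apply tspan_ext with (fun s => sum_n (fun j =>
    ((1 + (-1) ^ (v + j)) / 2 * a j) * cos (INR j * s)
    + ((1 + (-1) ^ (v + j)) / 2 * b j) * sin (INR j * s)) d).
  - intros s.
    assert (Hv : (-1) ^ v * (-1) ^ v = 1).
    { rewrite <- pow_add. replace (v + v)%nat with (2 * v)%nat by lia. apply pow_1_even. }
    transitivity (/ 2 * g s + / 2 * (-1) ^ v * g (s + PI)).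
    2: { rewrite Hg. replace (/ 2 * g s + / 2 * (-1) ^ v * ((-1) ^ v * g s))
           with (/ 2 * g s + / 2 * ((-1) ^ v * (-1) ^ v) * g s) by ring. rewrite Hv. field. }
    rewrite !E.
    rewrite <- (Rplus_0_l (/ 2 * sum_n _ d)), <- (Rmult_0_r (INR (S d))).
    rewrite <- (sum_n_affine _ _ 0). apply sum_n_ext. intros j.
    replace (INR j * (s + PI)) with (INR j * s + INR j * PI) by ring.
    rewrite cos_plus_INR_PI, sin_plus_INR_PI, pow_add.
    match goal with |- @eq _ ?x ?y => change (@eq R x y) end. field.
  - apply (tspan_sum _ (fun j s => ((1 + (-1) ^ (v + j)) / 2 * a j) * cos (INR j * s)
      + ((1 + (-1) ^ (v + j)) / 2 * b j) * sin (INR j * s))).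
    intros j Hj. destruct (Nat.Even_Odd_dec (v + j)) as [He|Ho].
    + apply tspan_plus; [apply tspan_cos|apply tspan_sin]; auto.
    + apply tspan_ext with (fun _ => 0); [|apply tspan_zero].
      intros t. rewrite pow_m1_odd; [field|].
      intros He. exact (Nat.Even_Odd_False _ He Ho).
Qed.

Lemma O_eps_scale_parameter k c F : Rabs c = 1 -> O_eps k F -> O_eps k (fun t e => F t (c * e)).
Proof.
  intros Hc [K [d HK]]. exists K, d. intros e He t.
  replace (Rabs e) with (Rabs (c * e)) by (rewrite Rabs_mult, Hc; ring).
  apply HK. revert He. unfold ball; simpl; unfold AbsRing_ball, abs, minus, plus, opp; simpl.
  rewrite Ropp_0, !Rplus_0_r, Rabs_mult, Hc, Rmult_1_l. auto.
Qed.

(** Taking c = 1 or c = -1 covers both symmetries at once. Both sides of the symmetry are expanded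
    and compared by uniqueness of the coefficients. *)
Lemma expansion_symmetry e0 h hk c : 0 < e0 -> Rabs c = 1 -> asymp_expansion h hk ->
  (forall s e, Rabs e <= e0 -> h (s + PI) e = h s (c * e)) ->
  forall k s, (1 <= k)%nat -> hk k (s + PI) = c ^ k * hk k s.
Proof.
  intros He0 Hc Hexp Hsym k s Hk.
  (* The index 0 is set to 0: the two constant terms 1 cancel, and [hk 0] does not occur in the
     expansion. *)
  pose (a := fun i t => if Nat.eq_dec i 0 then 0 else hk i (t + PI) - c ^ i * hk i t).
  assert (H : O_eps (S k) (fun t e => sum_n (fun i => e ^ i * a i t) (S k))).
  { apply (O_eps_le (S (S k))); [lia|].
    apply (O_eps_ext_loc _ _ (fun t e =>
      (h t (c * e) - (1 + sum_n_m (fun i => (c * e) ^ i * hk i t) 1 (S k)))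
      - (h (t + PI) e - (1 + sum_n_m (fun i => e ^ i * hk i (t + PI)) 1 (S k))))).
    - generalize (locally_0_Rabs_lt e0 He0); apply filter_imp. intros e He t.
      rewrite Hsym by lra. unfold sum_n. rewrite sum_Sn_m by lia.
      unfold a at 1. simpl (if Nat.eq_dec 0 0 then _ else _).
      rewrite (sum_n_m_ext_loc _ (fun i => plus (e ^ i * hk i (t + PI))
        (mult (-1) ((c * e) ^ i * hk i t)))).
      + rewrite sum_n_m_plus, (sum_n_m_mult_l (K := R_Ring)).
        change plus with Rplus. change mult with Rmult.
        assert (Hxy : forall x y z u : R, u * 0 + (x + -1 * y) = z - (1 + y) - (z - (1 + x)))
          by (intros; ring). apply Hxy.
      + intros i Hi. unfold a. destruct (Nat.eq_dec i 0); [lia|].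
        rewrite Rpow_mult_distr. change mult with Rmult. real_ring.
    - apply O_eps_minus.
      + apply (O_eps_scale_parameter _ c (fun t e => h t e -
          (1 + sum_n_m (fun i => e ^ i * hk i t) 1 (S k))) Hc), Hexp.
      + apply (O_eps_comp _ _ (fun t _ => t + PI) (Hexp (S k))). }
  pose proof (O_eps_coefficients _ _ H k (Nat.lt_succ_diag_r k) s) as E.
  unfold a in E. destruct (Nat.eq_dec k 0); [lia|]. lra.
Qed.

(** * Resonant harmonics and the orders at which they can appear *)

Lemma resonant_divide p q l : (1 <= q)%nat -> Nat.gcd p q = 1%nat ->
  cos (INR l * omega p q) = 1 -> Nat.divide q l.
Proof.
  intros Hq Hgcd H. pose proof PI_RGT_0 as Hpi.
  assert (Hq0 : INR q <> 0) by (apply not_0_INR; lia).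
  set (x := INR l * INR p / INR q * PI).
  replace (INR l * omega p q) with (2 * x) in H by (unfold x, omega; field; exact Hq0).
  rewrite cos_2a_sin in H.
  (* By the half-angle formula, l p / q is then an integer; Gauss's lemma finishes since p and q are
     coprime. *)
  assert (Hs : sin x = 0) by nra.
  apply sin_eq_0_0 in Hs. destruct Hs as [z Hz].
  assert (E : INR l * INR p = IZR z * INR q).
  { apply Rmult_eq_reg_r with (PI / INR q).
    - transitivity x; [unfold x; field; exact Hq0|]. rewrite Hz. field. exact Hq0.
    - apply Rmult_integral_contrapositive_currified; [lra|]. apply Rinv_neq_0_compat, Hq0. }
  rewrite !INR_IZR_INZ, <- !mult_IZR in E. apply eq_IZR in E.
  apply Nat.gauss with p; [|rewrite Nat.gcd_comm; exact Hgcd].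
  exists (Z.to_nat z). nia.
Qed.

Definition low_harmonics (n k l : nat) : Prop := (l <= n * k)%nat.

(** The parity of l is that of u k: u = 1 encodes anti-central symmetry, and u = 0 central symmetry,
    where all harmonics are even. *)
Definition parity_harmonics (n u k l : nat) : Prop := (l <= n * k)%nat /\ Nat.Even (u * k + l).

Lemma grading_low_harmonics n : grading (low_harmonics n).
Proof. unfold low_harmonics. split; [lia|split; intros; nia]. Qed.

Lemma grading_parity_harmonics n u : grading (parity_harmonics n u).
Proof.
  unfold parity_harmonics. split; [|split].
  - split; [lia|]. exists 0%nat. lia.
  - intros i j a b [Ha [x Hx]] [Hb [y Hy]]. split; [lia|].
    exists (x + y)%nat. lia.
  - intros i j a b [Ha [x Hx]] [Hb [y Hy]]. split; [lia|].
    (* Half of u (i + j) + |a - b|, since |a - b| = a + b - 2 min(a, b). *)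
    exists (x + y - Nat.min a b)%nat. lia.
Qed.

Lemma persists_nonresonant e0 h hk P p q m :
  (0 < p)%nat -> (2 * p < q)%nat -> Nat.gcd p q = 1%nat ->
  deformation e0 h hk -> grading P -> (forall k, (1 <= k)%nat -> tspan (P k) (hk k)) ->
  (forall k l, (1 <= k <= m)%nat -> P k l -> l <> 0%nat -> ~ Nat.divide q l) ->
  persists e0 h p q m.
Proof.
  intros Hp Hpq Hgcd Hdef HP Hhk Hres.
  assert (HG : graded_support P h).
  { exists hk. split; [exact Hhk|]. split; [apply Hdef|].
    apply (derivative_expansion e0 h hk P Hdef Hhk). }
  destruct (correction_exists e0 h P p q m) as [X [HX HO]]; auto.
  - lia.
  - apply Rgt_not_eq. pose proof PI_RGT_0 as Hpi. pose proof (lt_0_INR p Hp) as Hp'.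
    pose proof (lt_INR _ _ Hpq) as Hpq'. rewrite mult_INR in Hpq'. simpl in Hpq'.
    replace (omega p q / 2) with (PI * (INR p / INR q)) by (unfold omega; field; lra).
    assert (0 < INR p / INR q) by (apply Rdiv_lt_0_compat; lra).
    assert (INR p / INR q < 1).
    { apply Rmult_lt_reg_r with (INR q); [lra|]. unfold Rdiv. rewrite Rmult_assoc, Rinv_l; lra. }
    apply sin_gt_0; nra.
  - apply (deformation_regular _ _ _ Hdef).
  - intros k l Hk Hl Hl0 Hc. apply (Hres k l Hk Hl Hl0). apply (resonant_divide p); auto. lia.
  - apply (persists_of_correction e0 h hk P p q m X); auto.
Qed.

(** Clearing the denominator turns each formula for chi into an integer inequality: the order C - 1
    is still too low. *)
Lemma Zceil_div_lt a b : 0 < b -> (IZR (Zceil (a / b)) - 1) * b < a.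
Proof.
  intros Hb. destruct (Zceil_bound (a / b)) as [H _].
  replace a with (a / b * b) at 2 by (field; lra). apply Rmult_lt_compat_r; assumption.
Qed.

Theorem theorem2 (p q n : nat)
    (hp : (0 < p)%nat) (hpq : (2 * p < q)%nat) (hgcd : Nat.gcd p q = 1%nat)
    (hn : (1 <= n)%nat)
    (e0 : R) (h : R -> R -> R) (hdef : polynomial_deformation e0 h n)
    (chi : Z) (hchi : is_chi e0 h n q chi) :
  persists e0 h p q (Z.to_nat (chi - 1)).
Proof.
  destruct hdef as (hk & Hdef & Hpoly).
  assert (Hn : 0 < INR n) by (apply lt_0_INR; lia).
  pose proof Hdef as (He0 & _ & _ & Hexp).
  (* Both symmetries read h(s + pi; e) = h(s; (-1)^u e), so the coefficient of e^k is multiplied by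
     (-1)^(u k) under the half turn. *)
  assert (Hpar : forall u : nat,
    (forall s e, Rabs e <= e0 -> h (s + PI) e = h s ((-1) ^ u * e)) ->
    forall k, (1 <= k)%nat -> tspan (parity_harmonics n u k) (hk k)).
  { intros u Hsym k Hk. apply tspan_trig_poly_parity; [apply Hpoly, Hk|].
    intros s. rewrite pow_mult. apply (expansion_symmetry e0 h); auto.
    apply pow_1_abs. }
  destruct hchi as [Hs Hq|Hs Hq|Hs Hq|_ _].
  - assert (HC := Zceil_div_lt (INR q - INR n) (2 * INR n) ltac:(lra)).
    set (C := Zceil _) in *.
    rewrite !INR_IZR_INZ, <- (minus_IZR C 1), <- (mult_IZR 2), <- mult_IZR, <- minus_IZR in HC.
    apply lt_IZR in HC.
    apply (persists_nonresonant e0 h hk (parity_harmonics n 1)); auto using grading_parity_harmonics.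
    { apply Hpar. intros s e He. rewrite Hs by exact He. f_equal. ring. }
    intros k l Hk [Hl [x Hx]] Hl0 [y ->]. destruct Hq as [z ->].
    assert (Hkz : (Z.of_nat k <= 2 * C)%Z) by lia.
    destruct (Nat.Even_or_Odd k) as [[j ->]|[j ->]].
    (* For even k the multiple y q is even while q is odd, so y >= 2. *)
    + assert (Hy : (2 <= y)%nat) by (destruct y as [|[|y]]; lia).
      assert (Hj : (Z.of_nat j * (2 * Z.of_nat n) <= C * (2 * Z.of_nat n))%Z)
        by (apply Z.mul_le_mono_nonneg_r; lia).
      (* C >= 1 because 1 <= k, so [HC] gives n < q; this contradicts 2 q <= 2 n C < q + n. *)
      assert (0 <= (C - 1) * (2 * Z.of_nat n))%Z by (apply Z.mul_nonneg_nonneg; lia).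
      assert (2 * (2 * z + 1) <= y * (2 * z + 1))%nat by (apply Nat.mul_le_mono_r, Hy). lia.
    (* For odd k = 2 j + 1 <= 2 C one has j <= C - 1, so n k <= 2 n (C - 1) + n < q. *)
    + assert (Hj : (Z.of_nat j * (2 * Z.of_nat n) <= (C - 1) * (2 * Z.of_nat n))%Z)
        by (apply Z.mul_le_mono_nonneg_r; lia).
      assert (1 * (2 * z + 1) <= y * (2 * z + 1))%nat
        by (apply Nat.mul_le_mono_r; destruct y; lia). lia.
  - assert (HC := Zceil_div_lt (INR q) (2 * INR n) ltac:(lra)).
    set (C := Zceil _) in *.
    rewrite !INR_IZR_INZ, <- (minus_IZR C 1), <- (mult_IZR 2), <- mult_IZR in HC.
    apply lt_IZR in HC.
    apply (persists_nonresonant e0 h hk (parity_harmonics n 1)); auto using grading_parity_harmonics.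
    { apply Hpar. intros s e He. rewrite Hs by exact He. f_equal. ring. }
    intros k l Hk [Hl [x Hx]] Hl0 [y ->]. destruct Hq as [z ->].
    assert (Hkz : (Z.of_nat k <= 2 * C - 1)%Z) by lia.
    (* Multiples of an even q are even, so an odd k is excluded by parity; for k = 2 j <= 2 C - 1
       one has j <= C - 1, hence n k < q. *)
    destruct (Nat.Even_or_Odd k) as [[j ->]|[j ->]]; [|lia].
    assert (Hj : (Z.of_nat j * (2 * Z.of_nat n) <= (C - 1) * (2 * Z.of_nat n))%Z)
      by (apply Z.mul_le_mono_nonneg_r; lia).
    assert (1 * (2 * z) <= y * (2 * z))%nat
      by (apply Nat.mul_le_mono_r; destruct y; lia). lia.
  - assert (HC := Zceil_div_lt (2 * INR q) (INR n) Hn).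
    set (C := Zceil _) in *.
    rewrite !INR_IZR_INZ, <- (minus_IZR C 1), <- (mult_IZR 2), <- mult_IZR in HC.
    apply lt_IZR in HC.
    apply (persists_nonresonant e0 h hk (parity_harmonics n 0)); auto using grading_parity_harmonics.
    { apply Hpar. intros s e He. rewrite Hs by exact He. f_equal. ring. }
    intros k l Hk [Hl [x Hx]] Hl0 [y ->]. destruct Hq as [z ->].
    assert (Hj : (Z.of_nat k * Z.of_nat n <= (C - 1) * Z.of_nat n)%Z)
      by (apply Z.mul_le_mono_nonneg_r; lia).
    (* An even nonzero multiple of an odd q is at least 2 q, while n k <= n (C - 1) < 2 q. *)
    assert (2 * (2 * z + 1) <= y * (2 * z + 1))%nat
      by (apply Nat.mul_le_mono_r; destruct y as [|[|y]]; lia). lia.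
  - assert (HC := Zceil_div_lt (INR q) (INR n) Hn).
    set (C := Zceil _) in *.
    rewrite !INR_IZR_INZ, <- (minus_IZR C 1), <- mult_IZR in HC.
    apply lt_IZR in HC.
    apply (persists_nonresonant e0 h hk (low_harmonics n)); auto using grading_low_harmonics.
    { intros k Hk. apply tspan_trig_poly, Hpoly, Hk. }
    unfold low_harmonics. intros k l Hk Hl Hl0 [y ->].
    assert (Hj : (Z.of_nat k * Z.of_nat n <= (C - 1) * Z.of_nat n)%Z)
      by (apply Z.mul_le_mono_nonneg_r; lia).
    assert (1 * q <= y * q)%nat by (apply Nat.mul_le_mono_r; destruct y; lia). lia.
Qed.
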